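(* Let $\mathcal{G}_0$ be the family of isometry classes of pointed geodesic metric spaces, $\simeq$ the strong equivalence relation on $\mathcal{G}_0$, $\rho_0$ the pseudometric on $\mathcal{G}_0$ defined in the context (and also the induced metric on $\mathcal{G}_0/\!\simeq$), and $\mathcal{P}\mathcal{G}_0$ the family of isometry classes of pointed proper geodesic metric spaces equipped with the pointed Gromov-Hausdorff topology. Then the following hold. (1) $(\mathcal{G}_0/\!\simeq,\rho_0)$ is a compact metric space. (2) The natural projection from $\mathcal{P}\mathcal{G}_0$ to $\mathcal{G}_0/\!\simeq$ is a topological embedding map. (3) For any $\rho_0$-convergent sequence of pointed geodesic metric spaces, any pointed ultralimit is strongly equivalent to the $\rho_0$-limit.
   Context: All metric spaces are nonempty; an extended metric space has a metric with values in $[0,+\infty]$. For pointed extended metric spaces, $(X,x_0)\precsim(Y,y_0)$ means: for any $x_1,\dots,x_N\in X$ there are $y_{i,k}\in Y$ ($i=0,\dots,N$, $k=1,2,\dots$) with $y_{0,k}=y_0$ and $d_X(x_i,x_j)\le\liminf_{k\to\infty}d_Y(y_{i,k},y_{j,k})$ for any distinct $i,j\in\{0,1,\dots,N\}$. $(X,x_0)\sim(Y,y_0)$ means $\precsim$ in both directions. The pointed Gromov-Hausdorff distance $d_{\mathrm{GH}}((X,x_0),(Y,y_0))$ of pointed compact metric spaces is the infimum of $\max\{d_{\mathrm H}(\varphi(X),\psi(Y)),d_Z(\varphi(x_0),\psi(y_0))\}$ over all isometric embeddings $\varphi:X\to Z$, $\psi:Y\to Z$ into compact metric spaces $Z$.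 $\mathcal{H}_0$ is the set of isometry classes of pointed compact metric spaces; $\mathcal{H}_0(N,D)$ its subset of spaces with at most $N$ points and diameter $\le D$; $\mathcal{P}_{(X,x_0)}:=\{(Y,y_0)\in\mathcal{H}_0\mid(Y,y_0)\precsim(X,x_0)\}$. Define $$\rho_N((X,x_0),(Y,y_0)):=d_{\mathrm H}(\mathcal{P}_{(X,x_0)}\cap\mathcal{H}_0(N,N),\mathcal{P}_{(Y,y_0)}\cap\mathcal{H}_0(N,N)),\qquad \rho:=\sum_{N=1}^\infty2^{-N}\rho_N,$$ with $d_{\mathrm H}$ the Hausdorff distance with respect to the pointed GH metric. $B(x_0,r)$ is the closed metric ball with the restricted metric; $tX$ is $X$ with metric $t\,d_X$. For pointed geodesic metric spaces, $$\rho_0((X,x_0),(Y,y_0)):=\int_{(0,+\infty)}\rho\big((r^{-1}B(x_0,r),x_0),(r^{-1}B(y_0,r),y_0)\big)\,re^{-r^2}\,dr.$$ $(X,x_0)\simeq(Y,y_0)$ (strongly equivalent) means $(B(x_0,r),x_0)\sim(B(y_0,r),y_0)$ for every $r>0$. One has $\rho_0=0$ iff strongly equivalent, so $\rho_0$ induces a metric on $\mathcal{G}_0/\!\simeq$. (A strong equivalence class is determined by the family $(\mathcal{P}_{(B(x_0,r),x_0)})_{r>0}$, so $\mathcal{G}_0/\!\simeq$ can be treated as a set.) Pointed GH topology on $\mathcal{P}\mathcal{G}_0$: the coarsest topology making $(X,x_0)\mapsto(B(x_0,r),x_0)\in\mathcal{H}_0$ continuous for all $r>0$; so $(X_n,x_{0,n})\to(Y,y_0)$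 iff $(B(x_{0,n},r),x_{0,n})\to(B(y_0,r),y_0)$ in the pointed GH distance for every $r>0$. Pointed ultralimit: for a non-principal ultrafilter $\omega$ on the positive integers, the space of sequences $(x_n)\in\prod_nX_n$ with $\omega\text{-}\lim d_{X_n}(x_n,x_{0,n})<\infty$, with $d_\omega((x_n),(y_n))=\omega\text{-}\lim d_{X_n}(x_n,y_n)$, modulo zero distance, with base point the class of $(x_{0,n})$. *)

(* Defs.v *)
From HB Require Import structures.
From mathcomp Require Import all_boot all_order all_algebra generic_quotient.
From mathcomp Require Import all_classical all_reals all_analysis.

Set Implicit Arguments.
Unset Strict Implicit.
Unset Printing Implicit Defensive.

Import Order.TTheory GRing.Theory Num.Theory.
Import numFieldNormedType.Exports.

Local Open Scope classical_set_scope.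
Local Open Scope ring_scope.
Local Open Scope quotient_scope.

(* [metricType R] is not used for the spaces themselves: the collection of all
   of them must be a type on which one can put a topology and a metric, so
   their carriers have to live in a smaller universe than those of
   [topologicalType] and [metricType]. *)
Record mspace (R : realType) := MSpace {
  mcarrier :> Type;
  mfun : mcarrier -> mcarrier -> R;
  mfunxx : forall x, mfun x x = 0;
  mfun_eq0 : forall x y, mfun x y = 0 -> x = y;
  mfun_sym : forall x y, mfun x y = mfun y x;
  mfun_triangle : forall y x z, mfun x z <= mfun x y + mfun y z }.

HB.instance Definition _ (R : realType) (X : mspace R) :=
  gen_eqMixin (mcarrier X).
HB.instance Definition _ (R : realType) (X : mspace R) :=
  gen_choiceMixin (mcarrier X).
HB.instance Definition _ (R : realType) (X : mspace R) :=
  isMetric.Build R (mcarrier X)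
    (@mfunxx R X) (@mfun_eq0 R X) (@mfun_sym R X) (@mfun_triangle R X).

Record pmspace (R : realType) := PMSpace {
  pspace :> mspace R;
  base : pspace }.

HB.instance Definition _ (R : realType) := gen_eqMixin (pmspace R).
HB.instance Definition _ (R : realType) := gen_choiceMixin (pmspace R).

Definition isom_emb (R : realType) (X Y : metricType R) (f : X -> Y) :=
  forall x y, mdist (f x) (f y) = mdist x y.

Definition pisometric (R : realType) (X Y : pmspace R) :=
  exists f : X -> Y,
    [/\ isom_emb f, forall y, exists x, f x = y & f (base X) = base Y].

Section pisometric_equiv.
Variable R : realType.

Lemma pisometric_refl (X : pmspace R) : pisometric X X.
Proof. by exists id; split=> // y; exists y. Qed.

Lemma pisometric_sym (X Y : pmspace R) : pisometric X Y -> pisometric Y X.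
Proof.
move=> [f [fi fs fb]]; have [g fg] := choice fs.
exists g; split=> [x y|x|].
- by rewrite -[in RHS](fg x) -[in RHS](fg y) fi.
- by exists (f x); apply: mdist_positivity; rewrite -fi fg mdistxx.
- by apply: mdist_positivity; rewrite -fi fg fb mdistxx.
Qed.

Lemma pisometric_trans (X Y Z : pmspace R) :
  pisometric X Y -> pisometric Y Z -> pisometric X Z.
Proof.
move=> [f [fi fs fb]] [g [gi gs gb]]; exists (g \o f); split=> [x y|z|] /=.
- by rewrite gi fi.
- by have [y <-] := gs z; have [x <-] := fs y; exists x.
- by rewrite fb gb.
Qed.

Definition pisom_rel (X Y : pmspace R) : bool := `[< pisometric X Y >].

Lemma pisom_rel_equiv : equiv_class_of pisom_rel.
Proof.
split=> [X|X Y|Y X Z].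
- exact/asboolP/pisometric_refl.
- by apply/idP/idP => /asboolP/pisometric_sym ?; apply/asboolP.
- by move=> /asboolP XY /asboolP YZ; apply/asboolP/pisometric_trans/YZ.
Qed.

Canonical pisom_equiv : equiv_rel (pmspace R) :=
  EquivRelPack pisom_rel_equiv.

(* isometry classes of pointed metric spaces *)
Definition pmclass := {eq_quot pisom_equiv}.

HB.instance Definition _ := Choice.on pmclass.
HB.instance Definition _ := Quotient.on pmclass.
HB.instance Definition _ := EqQuotient.on pmclass.

End pisometric_equiv.

Section precsim.
Variable R : realType.

(* [dX] and [dY] are meant to be extended metrics *)
Definition precsim (X Y : Type) (dX : X -> X -> \bar R) (x0 : X)
    (dY : Y -> Y -> \bar R) (y0 : Y) :=
  forall (N : nat) (x : 'I_N.+1 -> X), x ord0 = x0 ->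
    exists y : 'I_N.+1 -> nat -> Y, (forall k, y ord0 k = y0) /\
      forall i j, i != j ->
        (dX (x i) (x j) <= limn_einf (fun k => dY (y i k) (y j k)))%E.

Definition emdist (X : metricType R) (x y : X) : \bar R := (mdist x y)%:E.

Definition pprecsim (X Y : pmspace R) :=
  precsim (@emdist X) (base X) (@emdist Y) (base Y).

Definition psim (X Y : pmspace R) := pprecsim X Y /\ pprecsim Y X.

Let limn_einf_lt (u : (\bar R)^nat) (b : \bar R) :
  (b < limn_einf u)%E -> \forall k \near \oo, (b < u k)%E.
Proof.
rewrite limn_einf_lim (cvg_lim _ (@cvg_einfs_sup R u))//.
move=> /ereal_sup_gt[_ [n _ <-] bn]; near=> k.
apply: (lt_le_trans bn); apply: ereal_inf_lbound; exists k => //=.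
by near: k; exists n.
Unshelve. all: by end_near. Qed.

Let limn_einf_ge (u : (\bar R)^nat) (a : R) :
  (forall n, (a - n.+1%:R^-1)%:E <= u n)%E -> (a%:E <= limn_einf u)%E.
Proof.
move=> au; apply/lee_subgt0Pr => e e0.
rewrite limn_einf_lim (cvg_lim _ (@cvg_einfs_sup R u))//.
have [n ne] : exists n, n.+1%:R^-1 < e :> R.
  exists (Num.truncn e^-1); rewrite invf_plt ?posrE//.
  by rewrite truncnS_gt.
apply: (@le_trans _ _ (einfs u n)); last by apply: ereal_sup_ubound; exists n.
apply: le_ereal_inf_tmp => _ [k /= nk <-].
apply: le_trans (au k); rewrite -EFinB lee_fin lerB// (le_trans _ (ltW ne))//.
by rewrite lef_pV2 ?posrE// ler_nat ltnS.
Qed.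

Lemma pprecsim_refl (X : pmspace R) : pprecsim X X.
Proof.
move=> N x x0; exists (fun i _ => x i); split=> // i j _.
by apply: limn_einf_ge => n; rewrite lee_fin gerBl invr_ge0.
Qed.

Lemma pprecsimP (X Y : pmspace R) : pprecsim X Y <->
  forall (N : nat) (x : 'I_N.+1 -> X) (e : R), x ord0 = base X -> 0 < e ->
    exists y : 'I_N.+1 -> Y, y ord0 = base Y /\
      forall i j, i != j -> mdist (x i) (x j) - e <= mdist (y i) (y j).
Proof.
split=> [XY N x e x0 e0|XY N x x0]; last first.
  have /choice[y yP] (k : nat) := XY N x k.+1%:R^-1 x0 (ltac:(by [])).
  exists (fun i k => y k i); split=> [k|i j ij]; first by have [] := yP k.
  by apply: limn_einf_ge => n; rewrite lee_fin; have [_] := yP n; exact.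
have [y [y0 yP]] := XY N x x0.
have : \forall k \near \oo, forall p : 'I_N.+1 * 'I_N.+1, p.1 != p.2 ->
    mdist (x p.1) (x p.2) - e <= mdist (y p.1 k) (y p.2 k).
  apply: filter_forall => -[i j]/=; have [->|ij] := eqVneq i j.
    by apply: nearW.
  have : ((mdist (x i) (x j) - e)%:E <
      limn_einf (fun k => emdist (y i k) (y j k)))%E.
    by apply: lt_le_trans (yP i j ij); rewrite lte_fin ltrBlDr ltrDl.
  move=> /limn_einf_lt; apply: filterS => k + _.
  by rewrite lte_fin => /ltW.
move=> [k _ /(_ k (leqnn k)) kP]; exists (fun i => y i k).
by split=> // i j ij; exact: (kP (i, j)).
Qed.

Lemma pprecsim_trans (X Y Z : pmspace R) :
  pprecsim X Y -> pprecsim Y Z -> pprecsim X Z.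
Proof.
move=> /pprecsimP XY /pprecsimP YZ; apply/pprecsimP => N x e x0 e0.
have e20 : 0 < e / 2 by rewrite divr_gt0.
have [y [y0 xy]] := XY N x (e / 2) x0 e20.
have [z [z0 yz]] := YZ N y (e / 2) y0 e20.
exists z; split=> // i j ij; apply: le_trans (yz i j ij).
by rewrite [in leLHS](splitr e) opprD addrA lerB// xy.
Qed.

End precsim.
Arguments emdist {R X}.

Section spaces.
Variable R : realType.
Implicit Types X Y : pmspace R.

Definition hausdorff_dist (T : Type) (d : T -> T -> \bar R) (A B : set T) :
    \bar R :=
  maxe (ereal_sup [set ereal_inf [set d a b | b in B] | a in A])
       (ereal_sup [set ereal_inf [set d a b | a in A] | b in B]).

Definition dGH X Y : \bar R :=
  ereal_inf [set e | exists (Z : mspace R) (phi : X -> Z) (psi : Y -> Z),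
    [/\ compact [set: Z], isom_emb phi, isom_emb psi &
      e = maxe (hausdorff_dist emdist (range phi) (range psi))
               (emdist (phi (base X)) (psi (base Y)))]].

Definition isoclass X : pmclass R := \pi X.

(* [repr C] is a representative of the isometry class [C]; the notions below
   are isometry invariant. *)
Definition dGHc (C D : pmclass R) : \bar R := dGH (repr C) (repr D).

Definition H0 : set (pmclass R) := isoclass @` [set X : pmspace R | compact [set: X]].

Definition H0b (N : nat) (D : R) : set (pmclass R) :=
  isoclass @` [set X : pmspace R | [/\ compact [set: X], ([set: X] #<= `I_N)%card &
                           forall x y : X, mdist x y <= D]].

Definition Pset X : set (pmclass R) := [set C | H0 C /\ pprecsim (repr C) X].

Definition rhoN (N : nat) X Y : \bar R :=
  hausdorff_dist dGHc (Pset X `&` H0b N N%:R) (Pset Y `&` H0b N N%:R).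

Definition rho X Y : \bar R :=
  (\sum_(1 <= N <oo) (2 ^- N)%:E * rhoN N X Y)%E.

Section rescaling.
Variables (X : pmspace R) (t : {posnum R}).
Let d (x y : X) : R := t%:num * mdist x y.

Let dxx x : d x x = 0. Proof. by rewrite /d mdistxx mulr0. Qed.

Let d_eq0 x y : d x y = 0 -> x = y.
Proof.
by move=> /eqP; rewrite mulf_eq0 gt_eqF//= => /eqP; exact: mdist_positivity.
Qed.

Let d_sym x y : d x y = d y x. Proof. by rewrite /d metric_sym. Qed.

Let d_triangle y x z : d x z <= d x y + d y z.
Proof. by rewrite /d -mulrDr ler_pM2l// metric_triangle. Qed.

Definition pscale : pmspace R :=
  @PMSpace R (MSpace dxx d_eq0 d_sym d_triangle) (base X).

End rescaling.

Section balls.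
Variables (X : pmspace R) (r : {posnum R}).
Let B := {x : X | mdist (base X) x <= r%:num}.
Let d (x y : B) : R := mdist (val x) (val y).

Let dxx x : d x x = 0. Proof. exact: mdistxx. Qed.

Let d_eq0 x y : d x y = 0 -> x = y.
Proof. by move=> /mdist_positivity/val_inj. Qed.

Let d_sym x y : d x y = d y x. Proof. exact: metric_sym. Qed.

Let d_triangle y x z : d x z <= d x y + d y z.
Proof. exact: metric_triangle. Qed.

Let base_subproof : mdist (base X) (base X) <= r%:num.
Proof. by rewrite mdistxx. Qed.

Definition pball : pmspace R :=
  @PMSpace R (MSpace dxx d_eq0 d_sym d_triangle)
    (exist (fun x : X => mdist (base X) x <= r%:num) (base X) base_subproof).

End balls.

Definition geodesic_space X := forall x y : X, exists g : R -> X,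
  [/\ g 0 = x, g (mdist x y) = y &
      forall s t, 0 <= s <= mdist x y -> 0 <= t <= mdist x y ->
        mdist (g s) (g t) = `|s - t|].

Definition proper_space X :=
  forall (x : X) (r : R), compact [set y : X | mdist x y <= r].

Definition G0 : set (pmclass R) := isoclass @` [set X : pmspace R | geodesic_space X].

Definition PG0 : set (pmclass R) :=
  isoclass @` [set X : pmspace R | proper_space X /\ geodesic_space X].

Definition G0_class X (gX : geodesic_space X) : set_type G0 :=
  SigSub (mem_set (imageP isoclass gX)).

(* [r] itself when [r > 0], the only case of interest; [1] otherwise *)
Definition to_posnum (r : R) : {posnum R} :=
  if pselect (0 < r) is left r0 then PosNum r0 else 1%:pos.

Definition unit_pball X (r : {posnum R}) : pmspace R :=
  pscale (pball X r) (r%:num^-1)%:pos.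

Definition rho0 X Y : \bar R :=
  (\int[lebesgue_measure]_(r in `]0%R, +oo[)
     (rho (unit_pball X (to_posnum r)) (unit_pball Y (to_posnum r)) *
      (r * expR (- r ^+ 2))%:E))%E.

Definition strong_equiv X Y := forall r : {posnum R}, psim (pball X r) (pball Y r).

End spaces.

Section GH_topology.
Variable R : realType.

Definition H0T : Type := set_type (@H0 R).
HB.instance Definition _ := Choice.on H0T.

Definition GH_open (U : set H0T) :=
  forall C, U C -> exists2 e : R, 0 < e &
    [set D : H0T | (dGHc (val C) (val D) < e%:E)%E] `<=` U.

Let GH_openT : GH_open setT. Proof. by move=> C _; exists 1. Qed.

Let GH_openI : setI_closed GH_open.
Proof.
move=> U V oU oV C [/oU[e e0 eU] /oV[e' e'0 e'V]].
exists (Num.min e e'); first by rewrite lt_min e0.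
move=> D /= CD; split; [apply: eU|apply: e'V] => /=; apply: lt_le_trans CD _.
  by rewrite lee_fin ge_min lexx.
by rewrite lee_fin ge_min lexx orbT.
Qed.

Let GH_open_bigcup (I : Type) (f : I -> set H0T) :
  (forall i, GH_open (f i)) -> GH_open (\bigcup_i f i).
Proof.
move=> of_ C [i _ /of_[e e0 eU]]; exists e => // D /eU fD; by exists i.
Qed.

HB.instance Definition _ :=
  isOpenTopological.Build H0T GH_openT GH_openI GH_open_bigcup.

Lemma isom_emb_continuous (X Y : metricType R) (f : X -> Y) :
  isom_emb f -> continuous f.
Proof.
move=> fi x; apply/metricType_numDomainType.cvgrPdist_lt => e e0.
apply/metricType_numDomainType.nbhs_mdistP; exists e => //= y.
by rewrite fi.
Qed.

Lemma proper_pisometric (X Y : pmspace R) :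
  pisometric X Y -> proper_space X -> proper_space Y.
Proof.
move=> [f [fi fs _]] pX y r; have [x <-] := fs y.
have -> : [set z : Y | mdist (f x) z <= r] = f @` [set z | mdist x z <= r].
  apply/seteqP; split=> [z /= fxz|_ [z /= xz <-]]; last by rewrite fi.
  by have [w wz] := fs z; exists w => //=; rewrite -fi wz.
apply: continuous_compact; last exact: pX.
exact/continuous_subspaceT/isom_emb_continuous.
Qed.

Lemma pball_compact (X : pmspace R) (r : {posnum R}) :
  proper_space X -> compact [set: pball X r].
Proof.
move=> pX F FF _; pose f (b : pball X r) : X := sval b.
have [] := pX (base X) r%:num (f @ F) _.
  by rewrite /= nbhs_simpl; apply: nearW => b; exact: (svalP b).
move=> x [/= xr xF]; exists (exist _ x xr); split=> // U V FU.
rewrite -metricType_numDomainType.filter_from_mdist_nbhs => -[e /= e0 eV].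
have [] := xF (f @` U) [set y | mdist x y < e].
- by apply: (@filterS _ F _ U (f @^-1` (f @` U))) FU => b Ub; exists b.
- by rewrite -metricType_numDomainType.filter_from_mdist_nbhs; exists e.
- by move=> _ [[b Ub <-] xb]; exists b; split=> //; exact: eV.
Qed.

Lemma isoclassP (X : pmspace R) : pisometric X (repr (isoclass X)).
Proof.
have : isoclass (repr (isoclass X)) = isoclass X by exact: reprK.
by move=> /eqP; rewrite eqmodE => /asboolP/pisometric_sym.
Qed.

Definition PG0T : Type := set_type (@PG0 R).
HB.instance Definition _ := Choice.on PG0T.

Lemma PG0_proper (C : PG0T) : proper_space (repr (val C)).
Proof.
case: C => C /= /set_mem[X [pX _] <-].
exact: proper_pisometric (isoclassP X) pX.
Qed.

Definition PG0_ball (r : {posnum R}) (C : PG0T) : H0T :=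
  SigSub (mem_set (imageP (@isoclass R) (@pball_compact _ r (@PG0_proper C)))).

HB.instance Definition _ := Topological.copy PG0T
  (sup_topology (fun r : {posnum R} =>
     Topological.class (initial_topology (PG0_ball r)))).

End GH_topology.

Section strong_quotient.
Variable R : realType.

Definition G0T : Type := set_type (@G0 R).
HB.instance Definition _ := Choice.on G0T.

Definition strong_rel (C D : G0T) : bool :=
  `[< strong_equiv (repr (val C)) (repr (val D)) >].

Lemma strong_rel_equiv : equiv_class_of strong_rel.
Proof.
split=> [C|C D|D C E].
- by apply/asboolP => r; split; exact: pprecsim_refl.
- by apply/idP/idP => /asboolP CD; apply/asboolP => r; have [] := CD r.
- move=> /asboolP CD /asboolP DE; apply/asboolP => r.
  have [CDr DCr] := CD r; have [DEr EDr] := DE r.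
  by split; [exact: pprecsim_trans DEr|exact: pprecsim_trans DCr].
Qed.

Canonical strong_equiv_rel : equiv_rel G0T := EquivRelPack strong_rel_equiv.

(* the quotient of the set of isometry classes of pointed geodesic spaces by
   strong equivalence *)
Definition G0q := {eq_quot strong_equiv_rel}.

HB.instance Definition _ := Choice.on G0q.
HB.instance Definition _ := Quotient.on G0q.
HB.instance Definition _ := EqQuotient.on G0q.

Definition strong_class (C : G0T) : G0q := \pi C.

Lemma PG0_sub_G0 : @PG0 R `<=` @G0 R.
Proof. by move=> _ [X [_ gX] <-]; exact: imageP. Qed.

Definition PG0_proj (C : PG0T R) : G0q :=
  strong_class (SigSub (mem_set (PG0_sub_G0 (set_valP C)))).

End strong_quotient.

Definition topological_embedding (S T : topologicalType) (f : S -> T) :=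
  [/\ injective f, continuous f &
      forall U : set S, open U ->
        exists2 V : set T, open V & f @` U = V `&` range f].

Section ultralimit.
Variables (R : realType) (omega : set_system nat) (UF : UltraFilter omega).
Variable X : nat -> pmspace R.

Lemma ultra_bounded_cvg (u : nat -> R) (M : R) :
  (\forall n \near omega, 0 <= u n <= M) -> cvg (u @ omega).
Proof.
move=> uM; have UuF : UltraFilter (u @ omega).
  split=> [|G GF uG]; first exact: fmap_proper_filter.
  apply/seteqP; split=> // A GA.
  have [//|nuA] := in_ultra_setVsetC (u @^-1` A) UF.
  have /(filterI GA) : G (~` A) by exact: uG.
  by rewrite setICr => /filter_not_empty.
have := @segment_compact R 0 M; rewrite compact_ultra => /(_ _ UuF)[|l [_ ul]].
  by apply: filterS uM => n; rewrite /= in_itv.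
by apply/cvg_ex; exists l.
Qed.

(* An ultrafilter limit in [0, +oo] always exists; being finite means that the
   sequence converges in R along omega. *)
Definition ubounded :=
  {x : forall n, X n | cvg (mdist (x n) (base (X n)) @[n --> omega])}.

Definition udist (x y : ubounded) : R :=
  lim (mdist (sval x n) (sval y n) @[n --> omega]).

Lemma udist_cvg (x y : ubounded) :
  mdist (sval x n) (sval y n) @[n --> omega] --> udist x y.
Proof.
have bnd (z : ubounded) : exists M : R,
    \forall n \near omega, mdist (sval z n) (base (X n)) <= M.
  exists (lim (mdist (sval z n) (base (X n)) @[n --> omega]) + 1).
  apply: (cvgr_le _ (svalP z)); by rewrite ltrDl.
have [M xM] := bnd x; have [N yN] := bnd y.
apply: (@ultra_bounded_cvg _ (M + N)).
near=> n; rewrite mdist_ge0/= (le_trans (metric_triangle _ (base (X n)) _))//.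
rewrite lerD//; first by near: n.
by rewrite metric_sym; near: n.
Unshelve. all: by end_near. Qed.

Lemma udistxx x : udist x x = 0.
Proof.
apply/cvg_lim => //; under eq_fun do rewrite mdistxx; exact: cvg_cst.
Qed.

Lemma udist_sym x y : udist x y = udist y x.
Proof. by rewrite /udist; under eq_fun do rewrite metric_sym. Qed.

Lemma udist_triangle y x z : udist x z <= udist x y + udist y z.
Proof.
apply: (ler_cvg_to (@udist_cvg x z) (cvgD (@udist_cvg x y) (@udist_cvg y z))).
by apply: nearW => n; exact: metric_triangle.
Qed.

(* the classes modulo zero distance *)
Definition ulim_carrier :=
  {C : ubounded -> Prop | exists x, C = fun y => udist x y = 0}.

Definition ulim_class (x : ubounded) : ulim_carrier :=
  exist _ (fun y => udist x y = 0) (ex_intro _ x erefl).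

Definition ulim_repr (C : ulim_carrier) : ubounded := projT1 (cid (svalP C)).

Let d (C D : ulim_carrier) : R := udist (ulim_repr C) (ulim_repr D).

Let dxx C : d C C = 0. Proof. exact: udistxx. Qed.

Let d_sym C D : d C D = d D C. Proof. exact: udist_sym. Qed.

Let d_triangle D C E : d C E <= d C D + d D E.
Proof. exact: udist_triangle. Qed.

Lemma udist_ge0 x y : 0 <= udist x y.
Proof.
by have := udist_triangle y x x; rewrite udistxx (udist_sym y) -mulr2n pmulrn_lge0.
Qed.

Let d_eq0 C D : d C D = 0 -> C = D.
Proof.
move=> xy; have repE E : sval E = (fun y => udist (ulim_repr E) y = 0).
  exact: (projT2 (cid (svalP E))).
have : sval C = sval D; last first.
  by case: C D {xy} => [C pC] [D pD] /= CD; exact: eq_exist.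
rewrite !repE; move: xy; rewrite /d.
move: (ulim_repr C) (ulim_repr D) => x y xy.
apply/funext => z; apply/propext; split=> [xz|yz]; apply/le_anti.
  rewrite udist_ge0 andbT (le_trans (udist_triangle x _ _))//.
  by rewrite udist_sym xy xz addr0.
by rewrite udist_ge0 andbT (le_trans (udist_triangle y _ _))// xy yz addr0.
Qed.

Let base_subproof : cvg (mdist (base (X n)) (base (X n)) @[n --> omega]).
Proof.
by under eq_fun do rewrite mdistxx; apply/cvg_ex; exists 0; exact: cvg_cst.
Qed.

Definition ultralimit : pmspace R :=
  @PMSpace R (MSpace dxx d_eq0 d_sym d_triangle)
    (ulim_class (exist _ (fun n => base (X n)) base_subproof)).

End ultralimit.

(* Main.v *)
Require Import Defs.
From HB Require Import structures.
From mathcomp Require Import all_boot all_order all_algebra generic_quotient.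
From mathcomp Require Import all_classical all_reals all_analysis.
From mathcomp Require Import measurable_realfun.
From mathcomp Require Import ring lra.

(* The pointed GH distance is half the least distortion of a pointed
   correspondence, and X precedes Y iff for all n and e every pointed n-tuple of
   X is dominated up to e by one of Y ([dom n e X Y]).  Mutual domination of
   large tuples with small error makes rho small: a finite space below X becomes
   a space below Y after passing to a net and shrinking it slightly; conversely
   small rho gives domination.  In geodesic spaces the balls of radii r and s
   dominate each other with error O(|r - s|), so r |-> rho(...) is
   equicontinuous; hence rho_0 is a pseudometric vanishing exactly on strongly
   equivalent pairs, and it is controlled by rho at finitely many rational radii
   (dominated convergence).

   For an ultralimit X_w of geodesic spaces X_n, tuples pass from X_n to X_w by
   definition, and from X_w to X_n because the distance matrices of tuples form
   a bounded set; so rho_0(X_n, X_w) tends to 0 along w.  This gives (3) and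
   sequential compactness, hence (1).  For (2): if Y is compact and dominates Z
   and is dominated by Z well enough, then a maximal separated tuple of Y with
   almost maximal sum of distances is nearly isometric to its image in Z, and
   both are nets, so Y and Z are GH-close.  An ultrafilter limit of
   correspondences between balls yields injectivity. *)

Set Implicit Arguments.
Unset Strict Implicit.
Unset Printing Implicit Defensive.

Import Order.TTheory GRing.Theory Num.Theory.
Import numFieldNormedType.Exports.

Local Open Scope classical_set_scope.
Local Open Scope ring_scope.

(** * Correspondences and the pointed Gromov-Hausdorff distance *)

(** A strict upper bound on an infimum yields witnesses, so triangle inequalities between infima are
    proved from real strict bounds. Nonnegativity excludes the indeterminate sums. *)
Lemma lee_triangle_lt (R : realType) (x y z : \bar R) :
  (0 <= x)%E -> (0 <= y)%E ->
  (forall a b : R, (x < a%:E)%E -> (y < b%:E)%E -> (z <= (a + b)%:E)%E) ->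
  (z <= x + y)%E.
Proof.
case: x => [x||]//; last by move=> _ y0 _;
  rewrite addye ?leey// -ltNye (lt_le_trans _ y0).
case: y => [y||]//; last by move=> _ _ _; rewrite addey ?leey.
move=> _ _ h; apply/lee_addgt0Pr => e e0.
have := h (x + e / 2) (y + e / 2); rewrite !lte_fin !ltrDl divr_gt0//.
by move=> /(_ isT isT); rewrite addrACA -splitr EFinD EFinD.
Qed.

Section hausdorff_dist.
Variables (R : realType) (T : Type) (d : T -> T -> \bar R).
Local Open Scope ereal_scope.

Lemma hausdorff_dist_le (A B : set T) e :
  (forall a, A a -> exists2 b, B b & d a b <= e) ->
  (forall b, B b -> exists2 a, A a & d a b <= e) -> hausdorff_dist d A B <= e.
Proof.
move=> AB BA; rewrite /hausdorff_dist ge_max; apply/andP; split.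
- apply: ge_ereal_sup => _ [a /AB[b Bb abe] <-].
  by apply: le_trans abe; apply: ereal_inf_lbound; exists b.
- apply: ge_ereal_sup => _ [b /BA[a Aa abe] <-].
  by apply: le_trans abe; apply: ereal_inf_lbound; exists a.
Qed.

Lemma hausdorff_dist_lt (A B : set T) e : hausdorff_dist d A B < e ->
  (forall a, A a -> exists2 b, B b & d a b < e) /\
  (forall b, B b -> exists2 a, A a & d a b < e).
Proof.
rewrite /hausdorff_dist gt_max => /andP[ABe BAe]; split=> [a Aa|b Bb].
- suff /ereal_inf_lt[_ [b Bb <-] ?] : ereal_inf [set d a b | b in B] < e.
    by exists b.
  by apply: le_lt_trans ABe; apply: ereal_sup_ubound; exists a.
- suff /ereal_inf_lt[_ [a Aa <-] ?] : ereal_inf [set d a b | a in A] < e.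
    by exists a.
  by apply: le_lt_trans BAe; apply: ereal_sup_ubound; exists b.
Qed.

(** The point of [A] excludes the case of two empty sets, where both suprema are -oo. *)
Lemma hausdorff_dist_ge0 (A B : set T) : A !=set0 ->
  (forall a b, 0 <= d a b) -> 0 <= hausdorff_dist d A B.
Proof.
move=> [a Aa] d0; rewrite /hausdorff_dist le_max; apply/orP; left.
apply: (@le_trans _ _ (ereal_inf [set d a b | b in B])).
  by apply: le_ereal_inf_tmp => _ [b _ <-].
by apply: ereal_sup_ubound; exists a.
Qed.

Lemma hausdorff_dist_sym (A B : set T) : (forall a b, d a b = d b a) ->
  hausdorff_dist d A B = hausdorff_dist d B A.
Proof.
move=> ds; rewrite /hausdorff_dist maxC; congr maxe; congr ereal_sup.
  by apply: eq_imagel => b _; congr ereal_inf; apply: eq_imagel.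
by apply: eq_imagel => b _; congr ereal_inf; apply: eq_imagel.
Qed.

End hausdorff_dist.

Section correspondences.
Variable R : realType.
Implicit Types X Y Z : pmspace R.

(** [Q] is a pointed correspondence of distortion at most [e]. Unlike embeddings into a third space,
    correspondences compose directly. *)
Definition pcorr (e : R) X Y := exists Q : X -> Y -> Prop,
  [/\ Q (base X) (base Y), forall x, exists y, Q x y,
      forall y, exists x, Q x y &
      forall x y x' y', Q x y -> Q x' y' ->
        `|mdist x x' - mdist y y'| <= e].

Lemma pcorr_sym e X Y : pcorr e X Y -> pcorr e Y X.
Proof.
move=> [Q [Q0 Q1 Q2 Qe]]; exists (fun y x => Q x y);
  split=> // x y x' y' xy xy'.
by rewrite distrC; exact: Qe.
Qed.

Lemma pcorr_trans e e' X Y Z : pcorr e X Y -> pcorr e' Y Z ->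
  pcorr (e + e') X Z.
Proof.
move=> [Q [Q0 Q1 Q2 Qe]] [S [S0 S1 S2 Se]].
exists (fun x z => exists2 y, Q x y & S y z); split.
- by exists (base Y).
- by move=> x; have [y xy] := Q1 x; have [z yz] := S1 y; exists z; exists y.
- by move=> z; have [y yz] := S2 z; have [x xy] := Q2 y; exists x; exists y.
- move=> x z x' z' [y xy yz] [y' xy' yz'].
  rewrite -(subrK (mdist y y') (mdist x x')) -addrA.
  by rewrite (le_trans (ler_normD _ _))// lerD// ?Qe// Se.
Qed.

Lemma pcorrW e e' X Y : e <= e' -> pcorr e X Y -> pcorr e' X Y.
Proof.
move=> ee' [Q [Q0 Q1 Q2 Qe]]; exists Q; split=> // x y x' y' xy xy'.
by apply: le_trans ee'; exact: Qe.
Qed.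

Lemma pisometric_pcorr X Y : pisometric X Y -> pcorr 0 X Y.
Proof.
move=> [f [fi fs fb]]; exists (fun x y => f x = y); split=> //.
  by move=> x; exists (f x).
by move=> x y x' y' <- <-; rewrite fi subrr normr0.
Qed.

Lemma dGH_ge0 X Y : (0 <= dGH X Y)%E.
Proof.
apply: le_ereal_inf_tmp => _ [Z [f [g [_ _ _ ->]]]].
by rewrite le_max; apply/orP; right; rewrite lee_fin mdist_ge0.
Qed.

Lemma dGH_sym X Y : dGH X Y = dGH Y X.
Proof.
have le X' Y' : (dGH X' Y' <= dGH Y' X')%E.
  apply: le_ereal_inf_tmp => _ [Z [f [g [cZ fi gi ->]]]].
  apply: ereal_inf_lbound; exists Z, g, f; split => //.
  have ms (x y : Z) : emdist x y = emdist y x by rewrite /emdist metric_sym.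
  by rewrite ms hausdorff_dist_sym.
by apply/eqP; rewrite eq_le !le.
Qed.

(** Points at distance less than [e] in the common space correspond; replacing both ends of a
    segment then changes its length by at most [2 * e]. *)
Lemma dGH_lt_pcorr e X Y : (dGH X Y < e%:E)%E -> pcorr (2 * e) X Y.
Proof.
move=> /ereal_inf_lt[_ [Z [f [g [cZ fi gi ->]]]]].
rewrite gt_max => /andP[/hausdorff_dist_lt[fg gf]]; rewrite lte_fin => b.
exists (fun x y => mdist (f x) (g y) < e); split => //.
- by move=> x; have [|_ [y _ <-]] := fg (f x); [exists x|exists y].
- by move=> y; have [|_ [x _ <-]] := gf (g y); [exists y|exists x].
- move=> x y x' y' xy xy'; rewrite -fi -gi.
  have := metric_triangle (f x) (g y) (f x').
  have := metric_triangle (g y) (g y') (f x').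
  have := metric_triangle (g y) (f x) (g y').
  have := metric_triangle (f x) (f x') (g y').
  rewrite (metric_sym (g y) (f x)) (metric_sym (g y') (f x')).
  by move=> *; rewrite ler_norml; apply/andP; split; lra.
Qed.

Section glue.
(* [X + Y] with [x] and [y] at distance [inf d(x, a) + e + d(b, y)] over
   corresponding [a] and [b]. *)
Variables (X Y : pmspace R) (Q : X -> Y -> Prop) (e : R).
Hypotheses (e0 : 0 < e) (Q0 : Q (base X) (base Y)).
Hypothesis Qe : forall x y x' y', Q x y -> Q x' y' ->
  `|mdist x x' - mdist y y'| <= 2 * e.

Let crossing (x : X) (y : Y) :=
  [set t | exists a b, Q a b /\ t = mdist x a + e + mdist b y].

Let cross x y : R := inf (crossing x y).

Let cross_le x y a b : Q a b -> cross x y <= mdist x a + e + mdist b y.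
Proof.
move=> Qab; apply: ge_inf; last by exists a, b.
by exists 0 => _ [a' [b' [_ ->]]]; rewrite !addr_ge0 ?mdist_ge0// ltW.
Qed.

Let le_cross x y t :
  (forall a b, Q a b -> t <= mdist x a + e + mdist b y) -> t <= cross x y.
Proof.
move=> h; apply: lb_le_inf; last by move=> _ [a [b [/h ? ->]]].
by exists (mdist x (base X) + e + mdist (base Y) y), (base X), (base Y).
Qed.

Let cross_gt0 x y : 0 < cross x y.
Proof.
apply: (lt_le_trans e0); apply: le_cross => a b _.
by have := mdist_ge0 x a; have := mdist_ge0 b y => *; lra.
Qed.

Let gd (u v : X + Y) : R := match u, v with
  | inl x, inl x' => mdist x x'
  | inr y, inr y' => mdist y y'
  | inl x, inr y => cross x y
  | inr y, inl x => cross x y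
  end.

Let gdxx u : gd u u = 0. Proof. by case: u => z /=; exact: mdistxx. Qed.

Let gd_eq0 u v : gd u v = 0 -> u = v.
Proof.
case: u v => [x|y] [x'|y'] /=.
- by move=> /mdist_positivity ->.
- by move=> h; have := cross_gt0 x y'; rewrite h ltxx.
- by move=> h; have := cross_gt0 x' y; rewrite h ltxx.
- by move=> /mdist_positivity ->.
Qed.

Let gd_sym u v : gd u v = gd v u.
Proof. by case: u v => [x|y] [x'|y'] //=; exact: metric_sym. Qed.

Let crossl x x' y : cross x y <= mdist x x' + cross x' y.
Proof.
rewrite -lerBlDl; apply: le_cross => a b Qab.
by have := cross_le x y Qab; have := metric_triangle x x' a => *; lra.
Qed.

Let crossr x y y' : cross x y <= cross x y' + mdist y' y.
Proof.
rewrite -lerBlDr; apply: le_cross => a b Qab.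
by have := cross_le x y Qab; have := metric_triangle b y' y => *; lra.
Qed.

(** The triangle inequalities with a detour through the other copy are those that use [Qe]: the
    detour crosses twice and pays [2 * e], which covers the distortion of [Q]. *)
Let cross_left x x' y : mdist x x' <= cross x y + cross x' y.
Proof.
rewrite -lerBlDr; apply: le_cross => a b Qab.
rewrite lerBlDr -lerBlDl; apply: le_cross => a' b' Qab'.
have := Qe Qab Qab'; rewrite ler_norml => /andP[_ +].
have := metric_triangle x a x'; have := metric_triangle a a' x'.
have := metric_triangle b y b'; rewrite (metric_sym a' x') (metric_sym y b').
by move=> *; lra.
Qed.

Let cross_right x y y' : mdist y y' <= cross x y + cross x y'.
Proof.
rewrite -lerBlDr; apply: le_cross => a b Qab.
rewrite lerBlDr -lerBlDl; apply: le_cross => a' b' Qab'.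
have := Qe Qab Qab'; rewrite ler_norml => /andP[+ _].
have := metric_triangle y b y'; have := metric_triangle b b' y'.
have := metric_triangle a x a'; rewrite (metric_sym y b) (metric_sym a x).
by move=> *; lra.
Qed.

Let gd_triangle v u w : gd u w <= gd u v + gd v w.
Proof.
case: u v w => [x|y] [x'|y'] [x''|y''] /=; try exact: metric_triangle.
- exact: crossl.
- exact: cross_left.
- exact: crossr.
- by rewrite addrC (metric_sym x' x'') crossl.
- exact: cross_right.
- by rewrite addrC (metric_sym y y') crossr.
Qed.

Let glue := MSpace gdxx gd_eq0 gd_sym gd_triangle.

Lemma glue_dGH : compact [set: X] -> compact [set: Y] ->
  (forall x, exists y, Q x y) -> (forall y, exists x, Q x y) ->
  (dGH X Y <= e%:E)%E.
Proof.
move=> cX cY Q1 Q2.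
have crossQ x y : Q x y -> cross x y <= e.
  by move=> xy; have := cross_le x y xy; rewrite !mdistxx addr0 add0r.
pose f : X -> glue := inl; pose g : Y -> glue := inr.
have fi : isom_emb f by [].
have gi : isom_emb g by [].
apply: (@le_trans _ _ (maxe (hausdorff_dist emdist (range f) (range g))
               (emdist (f (base X)) (g (base Y))))).
  apply: ereal_inf_lbound; exists glue, f, g; split=> //.
  have -> : [set: glue] = f @` setT `|` g @` setT.
    by apply/seteqP; split=> // -[z|z] _; [left|right]; exists z.
  by apply: compactU; apply: continuous_compact => //;
    apply: continuous_subspaceT; exact: isom_emb_continuous.
rewrite ge_max; apply/andP; split; last by rewrite lee_fin crossQ.
apply: hausdorff_dist_le => _ [z _ <-].
  have [y xy] := Q1 z; exists (g y); first by exists y.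
  by rewrite lee_fin crossQ.
have [x xy] := Q2 z; exists (f x); first by exists x.
by rewrite lee_fin crossQ.
Qed.

End glue.

(** Converse of [dGH_lt_pcorr], by gluing along the correspondence. A positive [e] keeps the two
    copies apart in the glued space. *)
Lemma pcorr_dGH e X Y : compact [set: X] -> compact [set: Y] -> 0 < e ->
  pcorr (2 * e) X Y -> (dGH X Y <= e%:E)%E.
Proof. by move=> cX cY e0 [Q [Q0 Q1 Q2 Qe]]; exact: (@glue_dGH X Y Q). Qed.

(** Composing correspondences replaces gluing two ambient spaces along [Y]. *)
Lemma dGH_triangle X Y Z : compact [set: X] -> compact [set: Y] ->
  compact [set: Z] -> (dGH X Z <= dGH X Y + dGH Y Z)%E.
Proof.
move=> cX cY cZ; apply: lee_triangle_lt => [||a b]; rewrite ?dGH_ge0//.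
move=> XYa YZb; apply: pcorr_dGH => //.
  rewrite addr_gt0//.
    by move: (le_lt_trans (dGH_ge0 _ _) XYa).
  by move: (le_lt_trans (dGH_ge0 _ _) YZb).
by rewrite mulrDr; apply: (@pcorr_trans _ _ X Y Z); exact: dGH_lt_pcorr.
Qed.

Lemma pisometric_compact X Y : pisometric X Y -> compact [set: X] ->
  compact [set: Y].
Proof.
move=> [f [fi fs _]] cX.
have -> : [set: Y] = f @` setT.
  by apply/seteqP; split=> // y _; have [x <-] := fs y; exists x.
by apply: continuous_compact => //; apply: continuous_subspaceT;
  exact: isom_emb_continuous.
Qed.

Lemma repr_isoclass_pcorr X : pcorr 0 X (repr (isoclass X)).
Proof. exact/pisometric_pcorr/isoclassP. Qed.

Lemma H0_compact (C : pmclass R) : H0 C -> compact [set: repr C].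
Proof. by move=> [X cX <-]; exact: pisometric_compact (isoclassP X) cX. Qed.

Lemma H0_isoclass X : compact [set: X] -> H0 (isoclass X).
Proof. by move=> cX; exists X. Qed.

Lemma dGHc_sym (C D : pmclass R) : dGHc C D = dGHc D C.
Proof. exact: dGH_sym. Qed.

Lemma dGHc_triangle (C D E : pmclass R) : H0 C -> H0 D -> H0 E ->
  (dGHc C E <= dGHc C D + dGHc D E)%E.
Proof. by move=> *; apply: dGH_triangle; exact: H0_compact. Qed.

Lemma dGHc_isoclass_lt e X Y : (dGHc (isoclass X) (isoclass Y) < e%:E)%E ->
  pcorr (2 * e) X Y.
Proof.
move=> /dGH_lt_pcorr XY; rewrite -[2 * e]add0r -[0 + _]addr0.
apply: pcorr_trans (pcorr_sym (repr_isoclass_pcorr Y)).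
exact: pcorr_trans (repr_isoclass_pcorr X) XY.
Qed.

Lemma pcorr_dGHc e X Y : compact [set: X] -> compact [set: Y] -> 0 < e ->
  pcorr (2 * e) X Y -> (dGHc (isoclass X) (isoclass Y) <= e%:E)%E.
Proof.
move=> cX cY e0 XY; apply: pcorr_dGH => //; try exact/H0_compact/H0_isoclass.
rewrite -[2 * e]add0r -[0 + _]addr0.
apply: pcorr_trans (repr_isoclass_pcorr Y).
exact: pcorr_trans (pcorr_sym (repr_isoclass_pcorr X)) XY.
Qed.

End correspondences.

(** * Domination of finite tuples *)

Lemma inj_card_leT (T U : Type) (f : T -> U) :
  injective f -> ([set: T] #<= [set: U])%card.
Proof.
move=> fi; apply: card_le_trans (card_leT (range f)).
by rewrite (card_le_eqr (inj_card_eq (in2W fi))).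
Qed.

Section subspaces.
Variables (R : realType) (X : pmspace R) (P : X -> Prop).
Hypothesis P0 : P (base X).
Let S := {x : X | P x}.
Let d (x y : S) : R := mdist (sval x) (sval y).

Let sval_inj : injective (sval : S -> X).
Proof. by move=> [x Px] [y Py] /= xy; exact: eq_exist. Qed.

Let dxx x : d x x = 0. Proof. exact: mdistxx. Qed.

Let d_eq0 x y : d x y = 0 -> x = y.
Proof. by move=> /mdist_positivity/sval_inj. Qed.

Let d_sym x y : d x y = d y x. Proof. exact: metric_sym. Qed.

Let d_triangle y x z : d x z <= d x y + d y z.
Proof. exact: metric_triangle. Qed.

Definition psub : pmspace R :=
  @PMSpace R (MSpace dxx d_eq0 d_sym d_triangle) (exist P (base X) P0).

Lemma psub_card_le : ([set: psub] #<= [set: X])%card.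
Proof. exact: (inj_card_leT sval_inj). Qed.

End subspaces.

Lemma finite_space_compact (R : realType) (X : pmspace R) n :
  ([set: X] #<= `I_n)%card -> compact [set: X].
Proof.
by move=> Xn; apply: finite_compact; exact: card_le_finite Xn (finite_II n).
Qed.

(** Index 0 is reserved for the base point, whence one index more than the cardinality bound;
    indices without a preimage also go to the base point. *)
Lemma finite_space_enum (R : realType) (X : pmspace R) n :
  ([set: X] #<= `I_n)%card ->
  exists2 u : 'I_n.+1 -> X, u ord0 = base X & forall x, exists i, u i = x.
Proof.
move=> /pcard_leP[f].
pose u (i : 'I_n.+1) : X :=
  if pselect (exists x, (f x).+1 = i :> nat) is left h then projT1 (cid h)
  else base X.
exists u => [|x].
  by rewrite /u; case: pselect => // h; case: cid.
have fxn : (f x < n)%N by have := @funS _ _ _ _ f; apply.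
exists (Ordinal (fxn : (f x).+1 < n.+1)%N); rewrite /u.
case: pselect => [h|[]]; last by exists x.
by case: cid => z /= [] /(@inj _ _ _ f); apply; rewrite inE.
Qed.

Section domination.
Variable R : realType.
Implicit Types X Y Z : pmspace R.

(** A finitary form of [pprecsim]: the size and the error are fixed and a single tuple replaces the
    sequence under the lower limit. Diagonal pairs are included, which forces [e] to be
    nonnegative. *)
Definition dom (n : nat) (e : R) X Y := forall x : 'I_n.+1 -> X,
  x ord0 = base X -> exists2 y : 'I_n.+1 -> Y, y ord0 = base Y &
    forall i j, mdist (x i) (x j) - e <= mdist (y i) (y j).

Lemma dom_trans n e e' X Y Z : dom n e X Y -> dom n e' Y Z ->
  dom n (e + e') X Z.
Proof.
move=> XY YZ x /XY[y /YZ[z z0 yz] xy]; exists z => // i j.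
by have := xy i j; have := yz i j => *; lra.
Qed.

Lemma domW n e e' X Y : e <= e' -> dom n e X Y -> dom n e' X Y.
Proof.
move=> ee' XY x /XY[y y0 xy]; exists y => // i j.
by have := xy i j => *; lra.
Qed.

(** Pad the shorter tuple with the base point, then forget the padding. *)
Lemma dom_leq m n e X Y : (m <= n)%N -> dom n e X Y -> dom m e X Y.
Proof.
move=> mn XY x x0.
have inord_widen k (km : (k < m.+1)%N) : inord k = Ordinal km.
  by apply: val_inj; rewrite /= inordK.
have [|y y0 xy] := XY (fun i => if (i <= m)%N then x (inord i) else base X).
  by rewrite leq0n -x0; congr x; rewrite (inord_widen 0 (ltn0Sn m));
    exact: val_inj.
exists (fun i => y (widen_ord (mn : m < n.+1)%N i)).
  by rewrite -y0; congr y; exact: val_inj.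
move=> i j; have := xy (widen_ord (mn : m < n.+1)%N i) (widen_ord (mn :
  m < n.+1)%N j).
by rewrite /= !leq_ord !inord_val.
Qed.

Lemma pcorr_dom n e X Y : pcorr e X Y -> dom n e X Y.
Proof.
move=> [Q [Q0 Q1 _ Qe]] x x0; have /choice[f fQ] := Q1.
(* The chosen partner of the base point need not be [base Y], so index 0 is treated apart. *)
pose y i := if i == ord0 :> 'I_n.+1 then base Y else f (x i).
have xy i : Q (x i) (y i) by rewrite /y; case: eqP => // ->; rewrite x0.
exists y => [|i j]; first by rewrite /y eqxx.
by have := Qe _ _ _ _ (xy i) (xy j); rewrite ler_norml => /andP[] *; lra.
Qed.

Lemma pprecsim_dom X Y : pprecsim X Y <-> forall n e, 0 < e -> dom n e X Y.
Proof.
rewrite pprecsimP; split=> [XY n e e0 x x0|XY n x e x0 e0].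
  have [y [y0 xy]] := XY n x e x0 e0; exists y => // i j.
  have [->|/xy//] := eqVneq i j; rewrite !mdistxx; lra.
by have [y y0 xy] := XY n e e0 x x0; exists y.
Qed.

Lemma pisometric_pprecsim X Y : pisometric X Y -> pprecsim X Y.
Proof.
move=> /pisometric_pcorr XY; apply/pprecsim_dom => n e e0.
by apply: pcorr_dom; apply: pcorrW XY; exact: ltW.
Qed.

Lemma expanding_pprecsim X Y (h : X -> Y) : h (base X) = base Y ->
  (forall x x', mdist x x' <= mdist (h x) (h x')) -> pprecsim X Y.
Proof.
move=> h0 hle; apply/pprecsim_dom => n e e0 x x0.
exists (h \o x) => [|i j] /=; first by rewrite x0.
by have := hle (x i) (x j) => *; lra.
Qed.

Lemma psub_pprecsim X (P : X -> Prop) (P0 : P (base X)) :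
  pprecsim (psub P0) X.
Proof.
exact: (@expanding_pprecsim _ _ (sval : psub P0 -> X) erefl (fun _ _ =>
  lexx _)).
Qed.

End domination.

Section separated_nets.
Variables (R : realType) (X : pmspace R) (n : nat) (u : 'I_n.+1 -> X) (d : R).

(** A maximal separated set of indices containing 0 is a net, since a far index could be added to
    it. Separation concerns indices, so a point repeated by [u] keeps at most one index in [S]. *)
Lemma separated_net : 0 < d -> exists S : {set 'I_n.+1},
  [/\ ord0 \in S,
      {in S &, forall i j, i != j -> d <= mdist (u i) (u j)} &
      forall i, exists2 j, j \in S & mdist (u i) (u j) < d].
Proof.
move=> d0.
pose P (S : {set 'I_n.+1}) := (ord0 \in S) &&
  [forall i in S, forall j in S, (i != j) ==> (d <= mdist (u i) (u j))].
have P1 : P [set ord0]%SET.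
  rewrite /P set11; apply/forall_inP => i /set1P ->.
  by apply/forall_inP => j /set1P ->; rewrite eqxx.
have [S /maxsetP[/andP[S0 /forall_inP SP] Smax] _] := maxset_exists P1.
have {}SP i j : i \in S -> j \in S -> i != j -> d <= mdist (u i) (u j).
  by move=> /SP/forall_inP h /h /implyP.
exists S; split=> // i; apply: contrapT => noj.
have far j : j \in S -> d <= mdist (u i) (u j).
  by move=> jS; rewrite leNgt; apply/negP => ?; apply: noj; exists j.
have iS : i \notin S.
  by apply/negP => iS; apply: noj; exists i => //; rewrite mdistxx.
have := Smax (i |: S)%SET; rewrite /P !inE S0 orbT finset.subsetUr/=.
have -> : [forall k in (i |: S)%SET, forall j in (i |: S)%SET,
    (k != j) ==> (d <= mdist (u k) (u j))].
  apply/forall_inP => k kS; apply/forall_inP => j jS; apply/implyP => kj.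
  move: kS jS kj; rewrite !inE => /predU1P[->|kS] /predU1P[->|jS] kj.
  - by rewrite eqxx in kj.
  - exact: far.
  - by rewrite metric_sym; exact: far.
  - exact: SP.
by move=> /(_ isT isT) /setP/(_ i); rewrite !inE eqxx (negbTE iS).
Qed.

End separated_nets.

(** * The pseudometric rho *)

Section rhoN.
Variable R : realType.
Implicit Types (X Y Z : pmspace R) (C D : pmclass R).

Lemma pprecsim_reprl X Y : pprecsim X Y -> pprecsim (repr (isoclass X)) Y.
Proof.
by apply: pprecsim_trans; exact/pisometric_pprecsim/pisometric_sym/isoclassP.
Qed.

(** This space precedes [X], so the sets compared by [rhoN] are nonempty. *)
Definition one_point X : pmspace R := psub (erefl (base X)).

Lemma one_point_card X : ([set: one_point X] #<= `I_1)%card.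
Proof.
have -> : [set: one_point X] = [set base (one_point X)].
  by apply/seteqP; split=> // -[x xb] _; exact: eq_exist.
by rewrite (card_le_eql card_set1) card_lexx.
Qed.

Lemma one_point_Pset N X : (0 < N)%N ->
  (Pset X `&` H0b N N%:R) (isoclass (one_point X)).
Proof.
move=> N0; have cX := finite_space_compact (one_point_card X).
split; first split; first exact: H0_isoclass.
  by apply/pprecsim_reprl; exact: psub_pprecsim.
exists (one_point X) => //; split=> //.
  by apply: card_le_trans (one_point_card X) _; rewrite card_le_II.
by move=> [x xb] [y yb]; rewrite (_ : mdist _ _ = mdist x y)// -xb -yb mdistxx.
Qed.

(** The full correspondence puts a space of diameter at most [N] within [N] of a point, and both
    families contain a one-point space. *)
Lemma rhoN_leN N X Y : (0 < N)%N -> (rhoN N X Y <= N%:R%:E)%E.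
Proof.
move=> N0; have N0R : 0 < N%:R :> R by rewrite ltr0n.
have le_pt C Z : H0b N N%:R C -> (dGHc C (isoclass (one_point Z)) <= N%:R%:E)%E.
  move=> [F [cF cardF diamF] <-]; apply: pcorr_dGHc => //.
    exact: finite_space_compact (one_point_card Z).
  exists (fun _ _ => True); split=> //.
    by move=> x; exists (base (one_point Z)).
    by move=> z; exists (base F).
  move=> x [z zb] x' [z' zb'] _ _.
  rewrite (_ : mdist (exist _ z zb : one_point Z) _ = mdist z z')//.
  rewrite -zb -zb' mdistxx subr0 ger0_norm ?mdist_ge0//.
  by have := diamF x x' => *; lra.
apply: hausdorff_dist_le => C [_ CN].
  by exists (isoclass (one_point Y)); [exact: one_point_Pset|exact: le_pt].
exists (isoclass (one_point X)); first exact: one_point_Pset.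
by rewrite dGHc_sym; exact: le_pt.
Qed.

Lemma rhoN_ge0 N X Y : (0 < N)%N -> (0 <= rhoN N X Y)%E.
Proof.
move=> N0; apply: hausdorff_dist_ge0 => [|C D]; last exact: dGH_ge0.
by exists (isoclass (one_point X)); exact: one_point_Pset.
Qed.

Lemma rhoN_sym N X Y : rhoN N X Y = rhoN N Y X.
Proof. by apply: hausdorff_dist_sym => C D; exact: dGHc_sym. Qed.

Lemma rhoN_triangle N X Y Z : (0 < N)%N ->
  (rhoN N X Z <= rhoN N X Y + rhoN N Y Z)%E.
Proof.
move=> N0; apply: lee_triangle_lt; rewrite ?rhoN_ge0// => a b.
move=> /hausdorff_dist_lt[XY YX] /hausdorff_dist_lt[YZ ZY].
apply: hausdorff_dist_le => C PC.
  have [D PD CD] := XY _ PC; have [E PE DE] := YZ _ PD; exists E => //.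
  apply: (@le_trans _ _ (dGHc C D + dGHc D E)%E).
    by apply: dGHc_triangle; [case: PC => -[]|case: PD => -[]|case: PE => -[]].
  by rewrite EFinD leeD// ltW.
have [D PD CD] := ZY _ PC; have [E PE DE] := YX _ PD; exists E => //.
apply: (@le_trans _ _ (dGHc E D + dGHc D C)%E).
  by apply: dGHc_triangle; [case: PE => -[]|case: PD => -[]|case: PC => -[]].
by rewrite EFinD leeD// ltW.
Qed.

(* A [d]-net of the finite space, shrunk by the factor [1 - d], absorbs the
   error [d ^+ 2]: its distances are at least [d] before shrinking. *)
Lemma Pset_approx N (d : R) X Y C : (0 < N)%N -> 0 < d < 1 ->
  dom N (d ^+ 2 / 2) X Y -> (Pset X `&` H0b N N%:R) C ->
  exists2 D, (Pset Y `&` H0b N N%:R) D & (dGHc C D <= (2 * d * N%:R)%:E)%E.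
Proof.
move=> N0 /andP[d0 d1] XY [[_ CX] [F [cF cardF diamF] FC]].
have N1 : 1 <= N%:R :> R by rewrite ler1n.
have FX : pprecsim F X.
  by apply: pprecsim_trans CX; rewrite -FC; exact/pisometric_pprecsim/isoclassP.
have [u u0 usurj] := finite_space_enum cardF.
have [S [S0 Ssep Snet]] := separated_net u d0.
have d20 : 0 < d ^+ 2 / 2 by rewrite divr_gt0// exprn_gt0.
(* The tuple [u] goes to [X] and then to [Y], losing [d ^+ 2 / 2] each time. *)
have [y y0 uy] : exists2 y : 'I_N.+1 -> Y, y ord0 = base Y &
    forall i j, mdist (u i) (u j) - d ^+ 2 <= mdist (y i) (y j).
  have /pprecsim_dom/(_ N _ d20)/(dom_trans)/(_ XY) FY := FX.
  by have [y y0] := FY u u0; rewrite -splitr; exists y.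
pose P (x : F) := exists2 i, i \in S & u i = x.
have P0 : P (base F) by exists ord0.
have t0 : 0 < 1 - d by rewrite subr_gt0.
pose t : {posnum R} := PosNum t0.
pose D := pscale (@psub R F P P0) t.
have mD (x z : D) : mdist x z = (1 - d) * mdist (sval x) (sval z) by [].
have cardD : ([set: D] #<= `I_N)%card by apply: card_le_trans (@psub_card_le R
  F P P0) cardF.
have diamD (x z : D) : mdist x z <= N%:R.
  rewrite mD; apply: le_trans (diamF (sval x) (sval z)).
  by rewrite ler_piMl ?mdist_ge0// gerBl ltW.
have cD := finite_space_compact cardD.
have idx (x : D) : exists i, i \in S /\ u i = sval x.
  by case: x => x [i iS ui]; exists i.
have [h hP] := choice idx.
have DY : pprecsim D Y.
  apply: (@expanding_pprecsim _ _ _ (y \o h)) => [|x z] /=.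
    (* Distinct indices in [S] carry points at distance at least [d], so the base point has only
       index 0 there. *)
    have [hS hb] := hP (base D); suff -> : h (base D) = ord0 by [].
    apply/eqP; apply: contraT => /Ssep; rewrite hS S0 => /(_ isT isT).
    by rewrite hb u0 mdistxx leNgt d0.
  rewrite mD; have [hxS hx] := hP x; have [hzS hz] := hP z.
  have [xz|xz] := eqVneq (h x) (h z).
    by rewrite -hx -hz xz !mdistxx mulr0.
  have := Ssep _ _ hxS hzS xz; rewrite hx hz => dxz.
  have := uy (h x) (h z); rewrite hx hz; apply: le_trans.
  by rewrite mulrBl mul1r lerB// expr2 ler_wpM2l// ltW.
exists (isoclass D).
  split; first by split; [exact: H0_isoclass|exact: pprecsim_reprl].
  by exists D.
rewrite -FC; apply: pcorr_dGHc => //;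
  first by rewrite !mulr_gt0// (lt_le_trans ltr01).
(* Moving both points to the net changes a distance by at most [2 * d], and shrinking changes it by
   at most [d * N%:R]; as [N] is at least 1, this fits into the distortion [2 * (2 * d * N%:R)]. *)
exists (fun x (z : D) => mdist x (sval z) < d); split.
- by rewrite /= mdistxx.
- move=> x; have [i <-] := usurj x; have [j jS ij] := Snet i.
  by exists (exist _ (u j) (ex_intro2 _ _ j jS erefl)).
- by move=> z; exists (sval z); rewrite mdistxx.
- move=> x z x' z' xz xz'; rewrite mD.
  have := metric_triangle x (sval z) x'.
  have := metric_triangle (sval z) (sval z') x'.
  have := metric_triangle (sval z) x (sval z').
  have := metric_triangle x x' (sval z').
  rewrite (metric_sym (sval z) x) (metric_sym (sval z') x').
  have := diamF (sval z) (sval z'); have := mdist_ge0 (sval z) (sval z').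
  move: (mdist (sval z) (sval z')) => m m0 mN *.
  have dm : d * m <= d * N%:R by rewrite ler_pM2l.
  have dm0 : 0 <= d * m by rewrite mulr_ge0// ltW.
  have dN : d <= d * N%:R by rewrite ler_peMr// ltW.
  by rewrite ler_norml; apply/andP; split; lra.
Qed.

Lemma rhoN_le_dom N (d : R) X Y : (0 < N)%N -> 0 < d < 1 ->
  dom N (d ^+ 2 / 2) X Y -> dom N (d ^+ 2 / 2) Y X ->
  (rhoN N X Y <= (2 * d * N%:R)%:E)%E.
Proof.
move=> N0 d01 XY YX; apply: hausdorff_dist_le => C PC.
  exact: (Pset_approx N0 d01 XY PC).
have [D PD CD] := Pset_approx N0 d01 YX PC.
by exists D => //; rewrite dGHc_sym.
Qed.

(** The points of a tuple form a subspace belonging to the family of [X]. A nearby member [D] of the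
    family of [Y] dominates it up to [2 * (e / 3)], and [Y] dominates [D] up to [e / 3]. *)
Lemma dom_of_rhoN_lt n N (e : R) X Y : (n < N)%N ->
  (forall x x' : X, mdist x x' <= N%:R) -> (rhoN N X Y < (e / 3)%:E)%E ->
  dom n e X Y.
Proof.
move=> nN diamX XYe x x0.
have e0 : 0 < e / 3.
  by move: (le_lt_trans (rhoN_ge0 _ _ (leq_ltn_trans (leq0n _) nN)) XYe).
pose P (z : X) := exists i, x i = z.
have P0 : P (base X) by exists ord0.
pose F := @psub R X P P0; pose f (i : 'I_n.+1) : F :=
  exist _ (x i) (ex_intro _ i erefl).
have cardF : ([set: F] #<= `I_N)%card.
  apply: (@card_le_trans _ _ _ `I_n.+1); last by rewrite card_le_II.
  have -> : [set: F] = (f \o inord) @` `I_n.+1.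
    apply/seteqP; split=> // -[z [i xz]] _; exists i => //=.
    by rewrite inord_val; exact: eq_exist.
  exact: card_image_le.
have cF := finite_space_compact cardF.
have [|D [[_ DY] _] FD] := (hausdorff_dist_lt XYe).1 (isoclass F).
  split; first split; first exact: H0_isoclass.
    by apply: pprecsim_reprl; exact: psub_pprecsim.
  by exists F => //; split=> // z z'; exact: diamX.
have : dom n e F Y.
  have -> : e = 0 + 2 * (e / 3) + e / 3 by lra.
  apply: (@dom_trans _ _ _ _ _ (repr D)); last first.
    by move/pprecsim_dom: DY; exact.
  apply: (@dom_trans _ _ _ _ _ (repr (isoclass F))).
    exact/pcorr_dom/repr_isoclass_pcorr.
  exact/pcorr_dom/dGH_lt_pcorr.
move=> /(_ f)[|y y0 fy]; last by exists y.
exact: eq_exist.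
Qed.

End rhoN.

Section rho.
Variable R : realType.
Implicit Types X Y Z : pmspace R.

(** These partial sums stay below 6, the source of the constant 6 in the bounds on [rho]. *)
Lemma sum_half_sqr (m : nat) :
  \sum_(1 <= N < m.+1) 2 ^- N * N%:R ^+ 2 =
    6 - (m%:R ^+ 2 + 4 * m%:R + 6) * 2 ^- m :> R.
Proof.
elim: m => [|m IH]; first by rewrite big_nil expr0 invr1; lra.
rewrite big_nat_recr//= IH -[m.+1%:R]natr1 [2 ^+ m.+1]exprS invfM.
by move: (2 ^- m) m%:R => a b; field.
Qed.

Lemma rho_ge0 X Y : (0 <= rho X Y)%E.
Proof.
apply: nneseries_ge0 => N N0 _; by rewrite mule_ge0 ?rhoN_ge0.
Qed.

Lemma rho_sym X Y : rho X Y = rho Y X.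
Proof.
by rewrite /rho; congr (limn _); apply/funext => m; apply: eq_bigr => N _;
  rewrite rhoN_sym.
Qed.

Lemma rho_triangle X Y Z : (rho X Z <= rho X Y + rho Y Z)%E.
Proof.
rewrite /rho -nneseriesD => [|N N0 _|N N0 _]; try by rewrite mule_ge0 ?rhoN_ge0.
apply: lee_lim.
- by apply: is_cvg_nneseries => N N0 _; rewrite mule_ge0 ?rhoN_ge0.
- by apply: is_cvg_nneseries => N N0 _; rewrite adde_ge0// mule_ge0 ?rhoN_ge0.
apply: nearW => m; rewrite big_nat_cond [leRHS]big_nat_cond.
apply: lee_sum => N /andP[/andP[N0 _] _]; rewrite -ge0_muleDr ?rhoN_ge0//.
by rewrite lee_wpmul2l// rhoN_triangle.
Qed.

Lemma rho_le X Y c : 0 <= c ->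
  (forall N, (0 < N)%N -> (rhoN N X Y <= (c * N%:R ^+ 2)%:E)%E) ->
  (rho X Y <= (6 * c)%:E)%E.
Proof.
move=> c0 rc.
apply: lime_le.
  by apply: is_cvg_nneseries => N N0 _; rewrite mule_ge0 ?rhoN_ge0.
apply: nearW => -[|m]; first by rewrite big_geq// lee_fin mulr_ge0.
apply: (@le_trans _ _ (\sum_(1 <= N < m.+1) (c * (2 ^- N * N%:R ^+ 2))%:E)%E).
  rewrite big_nat_cond [leRHS]big_nat_cond.
  apply: lee_sum => N /andP[/andP[N0 _] _].
  by rewrite mulrCA EFinM lee_wpmul2l// rc.
rewrite sumEFin lee_fin -mulr_sumr sum_half_sqr mulrC ler_wpM2r//.
by rewrite gerBl mulr_ge0 ?addr_ge0 ?mulr_ge0 ?sqr_ge0 ?invr_ge0.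
Qed.

Lemma rho_le6 X Y : (rho X Y <= 6%:E)%E.
Proof.
rewrite -[6%:E]/((6%:R : R)%:E) -[6%:R]mulr1; apply: rho_le => // N N0.
apply: le_trans (rhoN_leN X Y N0) _; rewrite lee_fin mul1r expr2.
by rewrite ler_peMr// ler1n.
Qed.

Lemma rho_fin_num X Y : rho X Y \is a fin_num.
Proof.
by rewrite ge0_fin_numE ?rho_ge0// (le_lt_trans (rho_le6 X Y))// ltry.
Qed.

(** Terms with [N] at most [M] are controlled by domination, and the later ones by the trivial
    bound, where [N%:R] is at most [N%:R ^+ 2 / M.+1%:R]. The quadratic growth in [rho_le]
    accommodates both. *)
Lemma rho_le_dom M (d : R) X Y : 0 < d < 1 ->
  dom M (d ^+ 2 / 2) X Y -> dom M (d ^+ 2 / 2) Y X ->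
  (rho X Y <= (6 * (2 * d + M.+1%:R^-1))%:E)%E.
Proof.
move=> d01 XY YX; have /andP[d0 _] := d01.
apply: rho_le => [|N N0]; first by rewrite addr_ge0 ?mulr_ge0 ?invr_ge0// ltW.
have N1 : 1 <= N%:R :> R by rewrite ler1n.
have M0 : 0 < M.+1%:R :> R by rewrite ltr0n.
have NN : N%:R <= N%:R ^+ 2 :> R by rewrite expr2 ler_peMr.
have [NM|MN] := leqP N M.
  apply: le_trans (rhoN_le_dom N0 d01 (dom_leq NM XY) (dom_leq NM YX)) _.
  rewrite lee_fin (mulrDl (2 * d)).
  apply: (@le_trans _ _ (2 * d * N%:R ^+ 2)).
    by rewrite ler_wpM2l// mulr_ge0// ltW.
  by rewrite lerDl mulr_ge0 ?invr_ge0 ?sqr_ge0.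
apply: le_trans (rhoN_leN X Y N0) _; rewrite lee_fin (mulrDl (2 * d)).
apply: (@le_trans _ _ (M.+1%:R^-1 * N%:R ^+ 2)).
  by rewrite mulrC ler_pdivlMr// expr2 ler_wpM2l// ler_nat.
by rewrite lerDr !mulr_ge0 ?sqr_ge0// ltW.
Qed.

(** A single term of the series suffices, and [2 ^- N] is its weight. *)
Lemma dom_of_rho_lt n N (e : R) X Y : (n < N)%N ->
  (forall x x' : X, mdist x x' <= N%:R) ->
  (rho X Y < (2 ^- N * (e / 3))%:E)%E -> dom n e X Y.
Proof.
move=> nN dX XY; have N0 : (0 < N)%N by exact: leq_ltn_trans nN.
apply: (dom_of_rhoN_lt nN dX).
have : ((2 ^- N)%:E * rhoN N X Y <= rho X Y)%E.
  apply: (@le_trans _ _ (\sum_(1 <= i < N.+1) (2 ^- i)%:E * rhoN i X Y)%E).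
    rewrite big_nat_recr//= leeDr// big_nat_cond sume_ge0// =>
      i /andP[/andP[i0 _] _].
    by rewrite mule_ge0 ?rhoN_ge0.
  by apply: nneseries_lim_ge => i i0 _; rewrite mule_ge0 ?rhoN_ge0.
by move=> /le_lt_trans /(_ XY); rewrite EFinM lte_pmul2l.
Qed.

Lemma psim_Pset X Y : psim X Y -> Pset X = Pset Y.
Proof.
move=> [XY YX]; apply/seteqP; split=> C [C0 CX]; split=> //.
  exact: pprecsim_trans CX XY.
exact: pprecsim_trans CX YX.
Qed.

Lemma psim_rho X X' Y Y' : psim X X' -> psim Y Y' -> rho X Y = rho X' Y'.
Proof.
move=> /psim_Pset XX' /psim_Pset YY'; rewrite /rho.
congr (limn _); apply/funext => m; apply: eq_bigr => N _.
by rewrite /rhoN XX' YY'.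
Qed.

Lemma rhoxx X : rho X X = 0%E.
Proof.
apply/eqP; rewrite eq_le rho_ge0 andbT.
have := @rho_le X X 0 (lexx 0); rewrite mulr0; apply=> N N0.
rewrite mul0r; apply/lee_addgt0Pr => e e0; rewrite add0e.
apply: hausdorff_dist_le => C PC; exists C => //;
  (have [[C0 _] _] := PC; apply: pcorr_dGH => //; try exact: H0_compact;
   by apply: (@pcorrW _ 0); [rewrite mulr_ge0//
     ltW|exact/pisometric_pcorr/pisometric_refl]).
Qed.

(** As diameters are bounded, each tuple size is seen by some term of the series: its index is taken
    larger than the size and the diameter. *)
Lemma rho0_psim (X Y : pmspace R) (D : R) :
  (forall x x' : X, mdist x x' <= D) -> (forall y y' : Y, mdist y y' <= D) ->
  rho X Y = 0%E -> psim X Y.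
Proof.
move=> dX dY XY0.
have [M DM] : exists M : nat, D <= M%:R.
  by exists (Num.truncn D).+1; rewrite ltW// truncnS_gt.
have le Z W : (forall z z' : Z, mdist z z' <= D) -> rho Z W = 0%E ->
  pprecsim Z W.
  move=> dZ ZW0; apply/pprecsim_dom => n e e0.
  apply: (@dom_of_rho_lt _ (maxn n M).+1); first by rewrite ltnS leq_maxl.
    move=> z z'; apply: le_trans (dZ z z') _; apply: le_trans DM _.
    by rewrite ler_nat leqW// leq_maxr.
  by rewrite ZW0 lte_fin mulr_gt0 ?divr_gt0// invr_gt0 exprn_gt0.
by split; apply: le => //; rewrite rho_sym.
Qed.

End rho.

(** * Balls in geodesic spaces *)

Section balls.
Variable R : realType.
Implicit Types X Y Z : pmspace R.

Lemma rho_small_of_dom (e : R) : 0 < e -> exists (M : nat) (eta : R),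
  0 < eta /\ forall X Y, dom M eta X Y -> dom M eta Y X -> (rho X Y <= e%:E)%E.
Proof.
move=> e0; pose d := Num.min (1 / 2) (e / 24).
have d0 : 0 < d by rewrite lt_min !divr_gt0.
have dh : d <= 1 / 2 by rewrite ge_min lexx.
have de : d <= e / 24 by rewrite ge_min lexx orbT.
have d01 : 0 < d < 1 by rewrite d0/=; lra.
have [M Me] : exists M : nat, M.+1%:R^-1 <= e / 12 :> R.
  exists (Num.truncn (e / 12)^-1); rewrite invf_ple ?posrE ?divr_gt0//.
  by rewrite ltW// truncnS_gt.
exists M, (d ^+ 2 / 2); split; first by rewrite divr_gt0// exprn_gt0.
move=> X Y XY YX; apply: le_trans (rho_le_dom d01 XY YX) _; rewrite lee_fin.
by move: (M.+1%:R^-1) Me => m *; lra.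
Qed.

Lemma dom_of_rho_small n (e : R) : 0 < e -> exists2 theta : R, 0 < theta &
  forall X Y, (forall x x' : X, mdist x x' <= 2) ->
    (rho X Y < theta%:E)%E -> dom n e X Y.
Proof.
move=> e0; exists (2 ^- n.+2 * (e / 3)).
  by rewrite mulr_gt0 ?divr_gt0// invr_gt0 exprn_gt0.
move=> X Y dX; apply: dom_of_rho_lt => // x x'.
by apply: le_trans (dX x x') _; rewrite ler_nat.
Qed.

Lemma dom_pscale n e X Y (t : {posnum R}) :
  dom n (t%:num * e) (pscale X t) (pscale Y t) <-> dom n e X Y.
Proof.
have le (a b : R) : (t%:num * a - t%:num * e <= t%:num * b) = (a - e <= b).
  by rewrite -mulrBr ler_pM2l.
by split=> XY x /XY[y y0 xy]; exists y => // i j; have := xy i j;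
  rewrite -[_ (x i) _ - e <= _]le.
Qed.

Lemma dom_unit_pball n e X Y r :
  dom n e (unit_pball X r) (unit_pball Y r) <->
  dom n (r%:num * e) (pball X r) (pball Y r).
Proof.
rewrite /unit_pball; set t := (X in pscale _ X).
suff {1}<- : t%:num * (r%:num * e) = e by exact: dom_pscale.
by rewrite mulrA mulVf// mul1r.
Qed.

Lemma psim_unit_pball X Y r :
  psim (unit_pball X r) (unit_pball Y r) <-> psim (pball X r) (pball Y r).
Proof.
have h Z W : pprecsim (unit_pball Z r) (unit_pball W r) <->
    pprecsim (pball Z r) (pball W r).
  rewrite !pprecsim_dom; split=> ZW n e e0.
    have := ZW n (r%:num^-1 * e);
      rewrite mulr_gt0// => /(_ isT) /dom_unit_pball.
    by rewrite mulrA divff// mul1r.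
  by apply/dom_unit_pball/ZW; rewrite mulr_gt0.
by split=> -[] XY YX; split; exact/h.
Qed.

Lemma pball_diam X r (x y : pball X r) : mdist x y <= 2 * r%:num.
Proof.
case: x y => [x xr] [y yr]; rewrite (_ : mdist _ _ = mdist x y)//.
have := metric_triangle x (base X) y; rewrite (metric_sym x (base X)).
by move=> *; lra.
Qed.

Lemma unit_pball_diam X r (x y : unit_pball X r) : mdist x y <= 2.
Proof.
rewrite (_ : mdist x y = r%:num^-1 * mdist (x : pball X r) y)//.
by rewrite mulrC ler_pdivrMr// pball_diam.
Qed.

Lemma pisometric_strong_equiv X Y : pisometric X Y -> strong_equiv X Y.
Proof.
move=> XY r; have le Z W : pisometric Z W -> pprecsim (pball Z r) (pball W r).
  move=> [f [fi _ fb]].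
  have fr (z : pball Z r) : mdist (base W) (f (val z)) <= r%:num.
    by rewrite -fb fi; exact: (valP z).
  pose h z : pball W r := exist _ (f (val z)) (fr z).
  apply: (@expanding_pprecsim _ (pball Z r) (pball W r) h) => [|x x'];
    first exact: val_inj.
  by rewrite (_ : mdist (h x) _ = mdist (f (val x)) (f (val x')))// fi.
by split; apply: le => //; exact: pisometric_sym.
Qed.

Lemma strong_equiv_sym X Y : strong_equiv X Y -> strong_equiv Y X.
Proof. by move=> XY r; have [] := XY r. Qed.

Lemma strong_equiv_rho X X' Y Y' r : strong_equiv X X' -> strong_equiv Y Y' ->
  rho (unit_pball X r) (unit_pball Y r) = rho (unit_pball X' r) (unit_pball Y'
    r).
Proof. by move=> XX' YY'; apply: psim_rho; exact/psim_unit_pball. Qed.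

Lemma strong_equiv_rho0 X X' Y Y' : strong_equiv X X' -> strong_equiv Y Y' ->
  rho0 X Y = rho0 X' Y'.
Proof.
move=> XX' YY'; apply: eq_integral => r _.
by rewrite (strong_equiv_rho _ XX' YY').
Qed.

Lemma pisometric_geodesic X Y : pisometric X Y -> geodesic_space X ->
  geodesic_space Y.
Proof.
move=> [f [fi fs _]] gX y y'; have [x <-] := fs y; have [x' <-] := fs y'.
have [g [g0 g1 gd]] := gX x x'; exists (f \o g); rewrite fi /=.
by rewrite g0 g1; split=> // s t st ts; rewrite fi gd.
Qed.

(** Points farther than [s] from the base point are moved back along a geodesic to distance [s]; the
    others stay. *)
Lemma geodesic_retraction X (s : R) : geodesic_space X -> 0 <= s ->
  exists f : X -> X, forall x, mdist (base X) (f x) <= s /\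
    mdist x (f x) <= Num.max 0 (mdist (base X) x - s).
Proof.
move=> gX s0.
suff /choice[f fP] : forall x, exists x', mdist (base X) x' <= s /\
    mdist x x' <= Num.max 0 (mdist (base X) x - s) by exists f.
move=> x; have [xs|sx] := leP (mdist (base X) x) s.
  by exists x; rewrite mdistxx le_max lexx.
have [g [g0 g1 gd]] := gX (base X) x; exists (g s).
have s_in : 0 <= s <= mdist (base X) x by rewrite s0 ltW.
split; first by rewrite -{1}g0 gd// ?lexx ?mdist_ge0// sub0r normrN ger0_norm.
rewrite -{1}g1 gd// ?lexx ?mdist_ge0//.
by rewrite le_max ger0_norm ?lexx ?orbT// subr_ge0 ltW.
Qed.

(** Retract the larger ball onto the smaller one. Moving both endpoints costs twice the difference
    of the radii, and since the diameter is at most twice [r], the change of scale costs at most as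
    much again. *)
Lemma geodesic_dom_unit_pball n X (r s : {posnum R}) : geodesic_space X ->
  dom n (4 * `|r%:num - s%:num| / s%:num) (unit_pball X r) (unit_pball X s).
Proof.
move=> gX x x0.
have s0 : 0 <= s%:num by [].
have [f fP] := geodesic_retraction gX s0.
pose h (z : pball X r) : pball X s := exist _ (f (val z)) (fP (val z)).1.
have hb : h (base (pball X r)) = base (pball X s).
  apply: val_inj => /=; apply/esym/mdist_positivity.
  apply/le_anti; rewrite mdist_ge0 andbT.
  by apply: le_trans (fP (base X)).2 _;
    rewrite mdistxx ge_max lexx sub0r oppr_le0 s0.
exists (fun i => h (x i)) => [|i j]; first by rewrite x0.
have close (z : pball X r) : mdist (val z) (f (val z)) <= `|r%:num - s%:num|.
  apply: le_trans (fP (val z)).2 _; rewrite ge_max normr_ge0/=.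
  apply: le_trans (ler_norm _); rewrite lerD2r; exact: (valP z).
pose u : X := val (x i : pball X r); pose v : X := val (x j : pball X r).
rewrite (_ : mdist (x i) (x j) = r%:num^-1 * mdist u v)//.
rewrite (_ : mdist (h (x i) : unit_pball X s) _ = s%:num^-1 * mdist (f u) (f
  v))//.
have uv2 : mdist u v <= 2 * r%:num by exact: (pball_diam (x i :
  pball X r) (x j)).
have uf := close (x i); have vf := close (x j).
rewrite -/u in uf; rewrite -/v in vf.
have tri : mdist u v - 2 * `|r%:num - s%:num| <= mdist (f u) (f v).
  have := metric_triangle u (f u) v; have := metric_triangle (f u) (f v) v.
  by rewrite (metric_sym (f v) v) => *; lra.
have r0 : 0 < r%:num by [].
have {}s0 : 0 < s%:num by [].
rewrite -(ler_pM2l s0) mulrA divff ?gt_eqF// mul1r; apply: le_trans tri.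
have := ler_norm (r%:num - s%:num); have := ler_norm (s%:num - r%:num).
rewrite (distrC s%:num); move: `|_| => a h1 h2.
rewrite mulrBr mulrCA (mulrCA s%:num) divff ?gt_eqF// mulr1.
have : mdist u v * ((s%:num - r%:num) / r%:num) <= 2 * a.
  rewrite mulrA ler_pdivrMr// -mulrA [a * _]mulrC mulrA.
  apply: (@le_trans _ _ (mdist u v * a)); first by rewrite ler_wpM2l ?mdist_ge0.
  by rewrite ler_wpM2r//; lra.
have -> : mdist u v * ((s%:num - r%:num) / r%:num) =
    r%:num^-1 * (s%:num * mdist u v) - mdist u v.
  by field; rewrite gt_eqF.
by move=> *; lra.
Qed.

Lemma rho_unit_pball_equicontinuous (r : {posnum R}) (e : R) : 0 < e ->
  exists eta : R, [/\ 0 < eta, eta <= r%:num / 2 &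
    forall X (s : {posnum R}), geodesic_space X -> `|r%:num - s%:num| < eta ->
      (rho (unit_pball X r) (unit_pball X s) <= e%:E)%E].
Proof.
move=> e0; have [M [eta [eta0 small]]] := rho_small_of_dom e0.
have r0 : 0 < r%:num by [].
(* The first bound gives [r / 2 <= s]; the second then makes [4 * a / s], which is at most
   [8 * a / r], smaller than [eta]. *)
exists (Num.min (r%:num / 2) (eta * r%:num / 8)); split.
- by rewrite lt_min !divr_gt0 ?mulr_gt0.
- by rewrite ge_min lexx.
move=> X s gX; rewrite lt_min => /andP[]; set a := `|_| => a1 a2.
have sr : r%:num / 2 <= s%:num.
  by have := ler_norm (r%:num - s%:num); rewrite -/a => *; lra.
have s0 : 0 < s%:num by [].
apply: small.
  apply: (domW _ (@geodesic_dom_unit_pball M X r s gX));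
    rewrite -/a ler_pdivrMr//.
  have : eta * (r%:num / 2) <= eta * s%:num by rewrite ler_pM2l.
  by move=> *; lra.
apply: (domW _ (@geodesic_dom_unit_pball M X s r gX)).
rewrite distrC -/a ler_pdivrMr//.
have : 0 < eta * r%:num by rewrite mulr_gt0.
by move=> *; lra.
Qed.

End balls.

(** * The pseudometric rho_0 *)

Section rho0.
Variable R : realType.
Implicit Types (X Y Z : pmspace R) (r s e : R).
Local Notation mu := (@lebesgue_measure R).
Local Notation pos := (`]0, +oo[%classic : set R).

Definition rho_at X Y r : \bar R :=
  rho (unit_pball X (to_posnum r)) (unit_pball Y (to_posnum r)).

Definition weight r : R := r * expR (- r ^+ 2).

Lemma rho0E X Y :
  rho0 X Y = (\int[mu]_(r in pos) (rho_at X Y r * (weight r)%:E))%E.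
Proof. by []. Qed.

Lemma posE r : pos r = (0 < r) :> Prop.
Proof. by rewrite /= in_itv/= andbT. Qed.

Lemma to_posnumK r : 0 < r -> (to_posnum r)%:num = r.
Proof. by rewrite /to_posnum => r0; case: pselect. Qed.

Lemma weight_ge0 r : 0 <= r -> 0 <= weight r.
Proof. by move=> r0; rewrite mulr_ge0 ?expR_ge0. Qed.

Lemma weight_continuous : continuous (weight : R -> R).
Proof.
by move=> r; apply: cvgM; [exact: cvg_id|exact: continuous_gauss_fun].
Qed.

Lemma weight_lower_bound r s : 0 < r -> r / 2 <= s -> s <= 2 * r ->
  r / 2 * expR (- (2 * r) ^+ 2) <= weight s.
Proof.
move=> r0 rs sr; apply: ler_pM; rewrite ?expR_ge0//; first by lra.
by rewrite ler_expR lerN2 ler_sqr ?nnegrE//; lra.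
Qed.

Lemma integral_weight : (\int[mu]_(r in pos) (weight r)%:E = (1 / 2)%:E)%E.
Proof.
pose F (r : R) := - (1 / 2) * gauss_fun r.
have dF (r : R) : is_derive r 1 F (weight r).
  have dN : is_derive r 1 (fun r : R => - r ^+ 2) (- (2 * r)).
    by apply: is_derive_eq; rewrite /GRing.scale/= mulr1 mulr_natl mulr2n.
  have dE := @is_derive1_comp R expR (fun r : R =>
    - r ^+ 2) r _ _ (is_derive_expR _) dN.
  have dZ := is_deriveZ (- (1/2)) dE.
  by apply: is_derive_eq; rewrite /weight /GRing.scale/=; field.
rewrite integral_itv_obnd_cbnd; last first.
  apply/measurable_EFinP; apply: measurable_funTS.
  by apply: continuous_measurable_fun; exact: weight_continuous.
rewrite (@ge0_continuous_FTC2y _ _ F _ 0).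
- by rewrite /F /gauss_fun expr0n/= oppr0 expR0 mulr1 -EFinB sub0r opprK.
- exact: weight_ge0.
- by apply: continuous_subspaceT; exact: weight_continuous.
- by rewrite -[0](mulr0 (- (1 / 2))); apply: cvgMl_tmp; exact: cvg_gauss_fun.
- by move=> r _; exact: ex_derive.
- apply: cvg_at_right_filter; apply: cvgMl_tmp; exact: continuous_gauss_fun.
- by move=> r _; rewrite derive1E; exact: derive_val.
Qed.

Lemma rho_at_fin_num X Y r : rho_at X Y r \is a fin_num.
Proof. exact: rho_fin_num. Qed.

Lemma rho_at_ge0 X Y r : (0 <= rho_at X Y r)%E.
Proof. exact: rho_ge0. Qed.

Lemma rho_at_EFin X Y r : exists a : R, rho_at X Y r = a%:E.
Proof. by exists (fine (rho_at X Y r)); rewrite fineK// rho_at_fin_num. Qed.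

(** The radii [r] and [s] are compared inside each of the two spaces, with half of the error for
    each. That [eta] does not depend on the spaces is what later limit arguments rely on. *)
Lemma rho_at_equicontinuousE r e : 0 < r -> 0 < e ->
  exists eta : R, [/\ 0 < eta, eta <= r / 2 &
    forall X Y s, geodesic_space X -> geodesic_space Y -> `|r - s| < eta ->
      (rho_at X Y s <= rho_at X Y r + e%:E)%E /\
      (rho_at X Y r <= rho_at X Y s + e%:E)%E].
Proof.
move=> r0 e0; have e20 : 0 < e / 2 by rewrite divr_gt0.
have [eta [eta0 etar near_r]] := rho_unit_pball_equicontinuous (to_posnum r)
  e20.
rewrite to_posnumK// in etar near_r.
exists eta; split=> // X Y s gX gY rs.
have s0 : 0 < s by have := ler_norm (r - s) => *; lra.
have close Z : geodesic_space Z ->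
    (rho (unit_pball Z (to_posnum r)) (unit_pball Z (to_posnum s)) <= (e /
      2)%:E)%E.
  by move=> gZ; apply: near_r => //; rewrite to_posnumK.
have cX := close _ gX; have cY := close _ gY.
have tri (a b : {posnum R}) :
    (rho (unit_pball X b) (unit_pball X a) <= (e / 2)%:E)%E ->
    (rho (unit_pball Y a) (unit_pball Y b) <= (e / 2)%:E)%E ->
    (rho (unit_pball X b) (unit_pball Y b) <=
     rho (unit_pball X a) (unit_pball Y a) + e%:E)%E.
  move=> ha hb; apply: le_trans (rho_triangle _ (unit_pball X a) _) _.
  apply: (@le_trans _ _ ((e / 2)%:E +
      (rho (unit_pball X a) (unit_pball Y a) + (e / 2)%:E))%E).
    apply: (leeD ha); apply: le_trans (rho_triangle _ (unit_pball Y a) _) _.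
    exact: (leeD (lexx _) hb).
  by rewrite addeCA -EFinD -splitr.
have cXs := cX; rewrite rho_sym in cXs; have cYs := cY; rewrite rho_sym in cYs.
by split; [exact: tri cXs cY|exact: tri cX cYs].
Qed.

Opaque rho_at.

Lemma rho_at_equicontinuous r e : 0 < r -> 0 < e ->
  exists eta : R, [/\ 0 < eta, eta <= r / 2 &
    forall X Y s, geodesic_space X -> geodesic_space Y -> `|r - s| < eta ->
      `|fine (rho_at X Y r) - fine (rho_at X Y s)| <= e].
Proof.
move=> r0 e0; have [eta [eta0 etar near_r]] := rho_at_equicontinuousE r0 e0.
exists eta; split=> // X Y s gX gY rs; have [] := near_r X Y s gX gY rs.
have [a ->] := rho_at_EFin X Y r; have [b ->] := rho_at_EFin X Y s.
rewrite -!EFinD !lee_fin/= => h1 h2.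
by rewrite ler_norml; apply/andP; split; lra.
Qed.

(** By equicontinuity the integrand is continuous on the open half-line. *)
Lemma rho_at_measurable X Y : geodesic_space X -> geodesic_space Y ->
  measurable_fun pos (fun r => rho_at X Y r * (weight r)%:E)%E.
Proof.
move=> gX gY.
have -> : (fun r => rho_at X Y r * (weight r)%:E)%E =
    EFin \o (fun r => fine (rho_at X Y r) * weight r).
  by apply/funext => r; rewrite -[in LHS](fineK (rho_at_fin_num X Y r)).
apply/measurable_EFinP; apply: open_continuous_measurable_fun.
  exact: interval_open.
move=> r; rewrite inE posE => r0.
apply: cvgM; last exact: weight_continuous.
apply/cvgrPdist_le => e e0.
have [eta [eta0 _ near_r]] := rho_at_equicontinuous r0 e0.
near=> s; apply: (near_r X Y s gX gY).
by near: s; apply: cvgr_dist_lt eta0; exact: cvg_id.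
Unshelve. all: by end_near. Qed.

Lemma integrand_ge0 X Y r : pos r -> (0 <= rho_at X Y r * (weight r)%:E)%E.
Proof.
by rewrite posE => r0; rewrite mule_ge0 ?rho_at_ge0// lee_fin weight_ge0// ltW.
Qed.

Lemma rho0_ge0 X Y : (0 <= rho0 X Y)%E.
Proof. by apply: integral_ge0 => r; exact: integrand_ge0. Qed.

Lemma rho0_sym X Y : rho0 X Y = rho0 Y X.
Proof. by apply: eq_integral => r _; rewrite rho_sym. Qed.

Lemma rho0xx X : rho0 X X = 0%E.
Proof. by apply: integral0_eq => r _; rewrite rhoxx mul0e. Qed.

Lemma rho0_triangle X Y Z : geodesic_space X -> geodesic_space Y ->
  geodesic_space Z -> (rho0 X Z <= rho0 X Y + rho0 Y Z)%E.
Proof.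
move=> gX gY gZ; rewrite !rho0E -ge0_integralD//=; last 4 first.
- by move=> r; exact: integrand_ge0.
- exact: rho_at_measurable.
- by move=> r; exact: integrand_ge0.
- exact: rho_at_measurable.
apply: ge0_le_integral => //.
- by move=> r; exact: integrand_ge0.
- exact: rho_at_measurable.
- by apply: emeasurable_funD; exact: rho_at_measurable.
move=> r; rewrite posE => r0; rewrite -ge0_muleDl ?rho_at_ge0//.
by rewrite lee_wpmul2r ?rho_triangle// lee_fin weight_ge0// ltW.
Qed.

(** As [rho] is at most 6, this function dominates every integrand of [rho0]. *)
Lemma weight_integrable : mu.-integrable pos (fun r => (6 * weight r)%:E).
Proof.
apply/integrableP; split.
  apply/measurable_EFinP; apply: measurable_funTS; apply: measurable_funM => //.
  by apply: continuous_measurable_fun; exact: weight_continuous.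
have -> : (\int[mu]_(r in pos) `|(6 * weight r)%:E| =
    \int[mu]_(r in pos) (6%:E * (weight r)%:E))%E.
  apply: eq_integral => r; rewrite inE posE => r0.
  by rewrite gee0_abs ?EFinM// lee_fin mulr_ge0// weight_ge0// ltW.
rewrite ge0_integralZl//; last 2 first.
  apply/measurable_EFinP; apply: measurable_funTS.
  by apply: continuous_measurable_fun; exact: weight_continuous.
  by move=> r; rewrite posE => r0; rewrite lee_fin weight_ge0// ltW.
by rewrite integral_weight -EFinM ltry.
Qed.

Lemma integrand_le X Y r : pos r ->
  (`|rho_at X Y r * (weight r)%:E| <= (6 * weight r)%:E)%E.
Proof.
move=> pr; rewrite gee0_abs ?integrand_ge0// (EFinM 6 (weight r)).
apply: lee_wpmul2r; last exact: rho_le6.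
by move: pr; rewrite posE => r0; rewrite lee_fin weight_ge0// ltW.
Qed.

Lemma rho0_fin_num X Y : geodesic_space X -> geodesic_space Y ->
  rho0 X Y \is a fin_num.
Proof.
move=> gX gY; apply: integrable_fin_num => //.
apply: le_integrable weight_integrable => //; first exact: rho_at_measurable.
move=> r pr; rewrite [leRHS]gee0_abs; first exact: integrand_le.
by move: pr; rewrite posE => r0; rewrite lee_fin mulr_ge0// weight_ge0// ltW.
Qed.

(** By contraposition: a value at least [e] at [r] stays at least [e / 2] on the interval of length
    [eta] to the left of [r]. This interval lies in [[r / 2, r]], where the weight is at least
    [c]. *)
Lemma rho_at_of_rho0_small r e : 0 < r -> 0 < e ->
  exists2 theta : R, 0 < theta & forall X Y, geodesic_space X ->
    geodesic_space Y -> (rho0 X Y < theta%:E)%E -> (rho_at X Y r < e%:E)%E.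
Proof.
move=> r0 e0; have e20 : 0 < e / 2 by rewrite divr_gt0.
have [eta [eta0 etar near_r]] := rho_at_equicontinuous r0 e20.
pose c := r / 2 * expR (- (2 * r) ^+ 2).
have c0 : 0 < c by rewrite mulr_gt0 ?divr_gt0 ?expR_gt0.
exists (e / 2 * c * eta); first by apply: mulr_gt0 => //; exact: mulr_gt0.
move=> X Y gX gY; apply: contraTT; rewrite -!leNgt.
rewrite -(fineK (rho_at_fin_num X Y r)) lee_fin.
move=> er; have h b : fine (rho_at X Y r) - b <= e / 2 -> e / 2 <= b by lra.
pose I := `]r - eta, r[%classic : set R.
have mI : measurable I by exact: measurable_itv.
have Ipos : I `<=` pos.
  by move=> s; rewrite posE /I/= in_itv/= => /andP[] *; lra.
apply: (@le_trans _ _ (\int[mu]_(s in I) (e / 2 * c)%:E)%E).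
  rewrite integral_cst//= /I lebesgue_measure_itv/= lte_fin gtrBl eta0.
  by rewrite -EFinB -EFinM lee_fin opprB addrCA subrr addr0.
apply: (@le_trans _ _ (\int[mu]_(s in I) (rho_at X Y s * (weight s)%:E))%E).
  apply: ge0_le_integral => //=.
  - by move=> s _; rewrite lee_fin mulr_ge0// ltW.
  - exact: measurable_funS Ipos (rho_at_measurable gX gY).
  move=> s sI; have s0 : 0 < s by have := Ipos _ sI; rewrite posE.
  move: sI; rewrite /I/= in_itv/= => /andP[s1 s2].
  have rs : `|r - s| < eta by rewrite gtr0_norm; lra.
  have /ler_normlP[_ ers] := near_r X Y s gX gY rs.
  have es : e / 2 <= fine (rho_at X Y s) by apply: h ers.
  have ws : c <= weight s by apply: weight_lower_bound => //;
    clear -s1 s2 etar r0; lra.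
  rewrite -(fineK (rho_at_fin_num X Y s)) -(EFinM _ (weight s)) lee_fin.
  by apply: ler_pM => //; exact: ltW.
by apply: ge0_subset_integral => //=;
  [exact: rho_at_measurable|move=> s; exact: integrand_ge0].
Qed.

(* Non-positive values do no harm: [to_posnum] sends them to [1]. *)
Definition rat_enum (i : nat) : R := ratr (odflt 0 (unpickle i)).

Lemma rat_enum_dense r e : 0 < e -> exists i, `|r - rat_enum i| < e.
Proof.
move=> e0; have [|q] := @rat_in_itvoo R (r - e) (r + e); first by lra.
rewrite in_itv/= => /andP[q1 q2]; exists (pickle q).
by rewrite /rat_enum pickleK/= ltr_norml; apply/andP; split; lra.
Qed.

(** Pairs violating this for every [k] would have [rho_at] tending to 0 at each enumerated radius,
    hence at every positive radius by equicontinuity. Dominated convergence would make their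
    integrals tend to 0, although these are at least [e]. *)
Lemma rho0_small_of_rationals e : 0 < e -> exists k : nat, forall X Y,
  geodesic_space X -> geodesic_space Y ->
  (forall i, (i <= k)%N -> (rho_at X Y (rat_enum i) < k.+1%:R^-1%:E)%E) ->
  (rho0 X Y < e%:E)%E.
Proof.
move=> e0; apply: contrapT => /forallNP nok.
have /choice[XY XYP] : forall k, exists XY : pmspace R * pmspace R,
    [/\ geodesic_space XY.1, geodesic_space XY.2,
        forall i, (i <= k)%N ->
          (rho_at XY.1 XY.2 (rat_enum i) < k.+1%:R^-1%:E)%E &
        (e%:E <= rho0 XY.1 XY.2)%E].
  move=> k; have /existsNP[X /existsNP[Y]] := nok k.
  move=> /not_implyP[gX /not_implyP[gY /not_implyP[h /negP]]].
  by rewrite -leNgt => ?; exists (X, Y).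
pose f k r := (rho_at (XY k).1 (XY k).2 r * (weight r)%:E)%E.
have mf k : measurable_fun pos (f k).
  by have [gX gY _ _] := XYP k; exact: rho_at_measurable.
have fcvg r : pos r -> f ^~ r @ \oo --> 0%E.
  rewrite posE => r0.
  have -> : f ^~ r = fun k => (fine (rho_at (XY k).1 (XY k).2 r) * weight r)%:E.
    by apply/funext => k; rewrite EFinM fineK ?rho_at_fin_num.
  apply: cvg_EFin; first exact: nearW.
  rewrite -[0](mul0r (weight r)); apply: cvgMr_tmp; apply/cvgrPdist_le => d d0.
  have d20 : 0 < d / 2 by rewrite divr_gt0.
  have [eta [eta0 etar near_r]] := rho_at_equicontinuous r0 d20.
  have [i ri] := rat_enum_dense r eta0.
  have le_d (a b t : R) : 0 <= a -> a - b <= d / 2 -> b < t -> t <= d / 2 ->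
      `|0 - a| <= d.
    by move=> a0; rewrite sub0r normrN ger0_norm// => *; lra.
  near=> k; have [gX gY small _] := XYP k.
  have /ler_normlP[_ ab] := near_r (XY k).1 (XY k).2 (rat_enum i) gX gY ri.
  have ik : (i <= k)%N by near: k; exact: nbhs_infty_ge.
  have bk : fine (rho_at (XY k).1 (XY k).2 (rat_enum i)) < k.+1%:R^-1.
    by rewrite -lte_fin fineK ?rho_at_fin_num// small.
  apply: (le_d _ _ _ (fine_ge0 (rho_at_ge0 _ _ r)) ab bk).
  near: k; exists (Num.truncn (d / 2)^-1) => // k /= hk.
  rewrite invf_ple ?posrE// (le_trans (ltW (truncnS_gt _)))// ler_nat.
  by rewrite ltnS.
have f_ae : {ae mu, forall r, pos r ->
  f ^~ r @ \oo --> cst 0%E r} by exact: aeW.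
have f_le : {ae mu, forall r k, pos r -> (`|f k r| <= (6 * weight r)%:E)%E}.
  by apply: aeW => r k; exact: integrand_le.
have [_ _] := @dominated_convergence _ _ R mu pos (measurable_itv _) f
  (cst 0%E) _ mf (measurable_cst _) f_ae weight_integrable f_le.
rewrite integral0 => int0.
have : (e%:E <= limn (fun k => \int[mu]_(r in pos) f k r))%E.
  apply: lime_ge; first by apply/cvg_ex; exists 0%E.
  by apply: nearW => k; have [] := XYP k.
by rewrite (cvg_lim _ int0)// lee_fin leNgt e0.
Unshelve. all: by end_near. Qed.

End rho0.

(** * Ultralimits *)

Section ultralimits.
Variables (R : realType) (omega : set_system nat) (UF : UltraFilter omega).
Variable X : nat -> pmspace R.
Local Notation Xw := (ultralimit UF X).
Implicit Types (u v : ubounded omega X) (e : R).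

Lemma udist_near u v e : 0 < e ->
  \forall n \near omega, `|udist u v - mdist (sval u n) (sval v n)| < e.
Proof. by move=> e0; apply: cvgr_dist_lt => //; exact: udist_cvg. Qed.

Definition ulim u : Xw := ulim_class u.

Lemma ulim_reprE (p : Xw) : ulim (ulim_repr p) = p.
Proof.
case: p => P [x Px]; apply: eq_exist.
rewrite /ulim_repr/=; case: cid => y /= ->.
by [].
Qed.

Lemma ulimE (p : Xw) : exists u, p = ulim u.
Proof. by exists (ulim_repr p); rewrite ulim_reprE. Qed.

(** The distance of classes is computed on chosen representatives, which are at [udist] zero from
    the given sequences. *)
Lemma mdist_ulim u v : mdist (ulim u) (ulim v) = udist u v.
Proof.
have repr0 w : udist w (ulim_repr (ulim w)) = 0.
  rewrite /ulim_repr/=; case: cid => y /= wy.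
  have : udist y y = 0 by exact: udistxx.
  by rewrite -(congr1 (@^~ y) wy).
rewrite (_ : mdist _ _ = udist (ulim_repr (ulim u)) (ulim_repr (ulim v)))//.
have := repr0 v; have := repr0 u.
move: (ulim_repr (ulim u)) (ulim_repr (ulim v)) => u' v' uu vv.
apply/le_anti/andP; split.
  have := udist_triangle UF u u' v'; have := udist_triangle UF v u v'.
  by rewrite (udist_sym u' u) uu vv => *; lra.
have := udist_triangle UF u' u v; have := udist_triangle UF v' u' v.
by rewrite (udist_sym v' v) uu vv => *; lra.
Qed.

Lemma mdist_ulim_near u v e : 0 < e -> \forall n \near omega,
  `|mdist (ulim u) (ulim v) - mdist (sval u n) (sval v n)| < e.
Proof. by rewrite mdist_ulim; exact: udist_near. Qed.

Lemma mdist_ulim_le u v (M : R) :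
  (\forall n \near omega, mdist (sval u n) (sval v n) <= M) ->
  mdist (ulim u) (ulim v) <= M.
Proof.
move=> uvM; rewrite mdist_ulim.
exact: (ler_cvg_to (@udist_cvg _ _ UF _ u v) (cvg_cst M) uvM).
Qed.

Lemma eq_ulim u v :
  (forall e, 0 < e -> \forall n \near omega, mdist (sval u n) (sval v n) <= e)
    ->
  ulim u = ulim v.
Proof.
move=> uv; apply: mdist_positivity; apply/le_anti; rewrite mdist_ge0 andbT.
by apply/ler_addgt0Pl => e e0; rewrite addr0; exact/mdist_ulim_le/uv.
Qed.

Lemma ubounded_ex (x : forall n, X n) (M : R) :
  (\forall n \near omega, mdist (base (X n)) (x n) <= M) ->
  exists u, sval u = x.
Proof.
move=> xM; suff xc : cvg (mdist (x n) (base (X n)) @[n --> omega]) by exists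
  (exist _ x xc).
apply: (@ultra_bounded_cvg _ _ _ _ M).
by apply: filterS xM => n; rewrite metric_sym mdist_ge0.
Qed.

Lemma ubounded_base : exists b : ubounded omega X, sval b = (fun n =>
  base (X n)).
Proof. by apply: (@ubounded_ex _ 0); apply: nearW => n; rewrite mdistxx. Qed.

Lemma ubounded_bound u : exists M : R,
  \forall n \near omega, mdist (base (X n)) (sval u n) <= M.
Proof.
have [b bE] := ubounded_base.
exists (udist b u + 1); have := @udist_near b u 1 ltr01.
by apply: filterS => n /=; rewrite bE => /ltr_normlP[+ _] => *; lra.
Qed.

Lemma base_ulim u : (forall n, sval u n = base (X n)) -> ulim u = base Xw.
Proof.
move=> uE; apply: eq_ulim => e e0; apply: nearW => n.
by rewrite uE /= mdistxx ltW.
Qed.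

Lemma base_ulimE : exists2 b : ubounded omega X, sval b = (fun n =>
  base (X n)) & base Xw = ulim b.
Proof.
have [b bE] := ubounded_base.
by exists b => //; rewrite base_ulim// => n; rewrite bE.
Qed.

(** Follow geodesics of the [X n] at a common parameter. Their lengths [l n] only converge to [L],
    so [c n] clamps the parameter to [[0, l n]], with an error that vanishes along [omega]. *)
Lemma ultralimit_geodesic : (forall n, geodesic_space (X n)) ->
  geodesic_space Xw.
Proof.
move=> gX p q; have [u ->] := ulimE p; have [v ->] := ulimE q.
set L := mdist _ _; pose l n := mdist (sval u n) (sval v n).
have gex : forall n, exists g : R -> X n,
    [/\ g 0 = sval u n, g (l n) = sval v n &
      forall s t, 0 <= s <= l n -> 0 <= t <= l n ->
        mdist (g s) (g t) = `|s - t|].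
  by move=> n; exact: gX.
pose g n := projT1 (cid (gex n)).
have gP n : [/\ g n 0 = sval u n, g n (l n) = sval v n &
    forall s t, 0 <= s <= l n -> 0 <= t <= l n ->
      mdist (g n s) (g n t) = `|s - t|] by exact: projT2 (cid (gex n)).
pose c n s : R := Num.max 0 (Num.min s (l n)).
have c_itv n s : 0 <= c n s <= l n.
  by rewrite le_max lexx/= ge_max mdist_ge0/= ge_min lexx orbT.
have [Mu uM] := ubounded_bound u.
have lL e : 0 < e -> \forall n \near omega, `|L - l n| < e.
  by move=> e0; exact: mdist_ulim_near.
have /choice[w wE] s : exists w : ubounded omega X,
    sval w = fun n => g n (c n s).
  apply: (@ubounded_ex _ (Mu + (L + 1))); near=> n.
  apply: le_trans (metric_triangle _ (sval u n) _) _; apply: lerD.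
    by near: n.
  have [<- _ gd] := gP n; rewrite gd ?lexx ?mdist_ge0// sub0r normrN.
  have /andP[c0 cl] := c_itv n s; rewrite ger0_norm// (le_trans cl)//.
  have : `|L - l n| < 1 by near: n; exact: lL.
  by move=> /ltr_normlP[? ?]; lra.
have L0 : 0 <= L by exact: mdist_ge0.
exists (ulim \o w); split=> /=.
- apply: eq_ulim => e e0; apply: nearW => n; rewrite wE.
  have -> : c n 0 = 0 by rewrite /c min_l ?mdist_ge0// maxxx.
  by have [-> _ _] := gP n; rewrite mdistxx ltW.
- apply: eq_ulim => e e0; apply: filterS (lL e e0) => n /ltr_normlP[h1 h2].
  rewrite wE; have [_ <- gd] := gP n.
  rewrite gd ?c_itv ?mdist_ge0 ?lexx// /c max_r;
    last by rewrite le_min L0 mdist_ge0.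
  by rewrite ler_norml; case: (leP L (l n)) => ?; apply/andP; split; lra.
- move=> s t /andP[s0 sL] /andP[t0 tL].
  have near_st e : 0 < e -> \forall n \near omega,
      `| `|s - t| - mdist (sval (w s) n) (sval (w t) n)| < e.
    move=> e0; have e20 : 0 < e / 3 by rewrite divr_gt0.
    apply: filterS (lL _ e20) => n /ltr_normlP[h1 h2].
    rewrite !wE; have [_ _ ->] := gP n; rewrite ?c_itv//.
    apply: le_lt_trans (ler_dist_dist _ _) _.
    have close z : 0 <= z -> z <= L -> `|z - c n z| <= e / 3.
      move=> z0 zL; rewrite /c max_r; last by rewrite le_min z0 mdist_ge0.
      by rewrite ler_norml; case: (leP z (l n)) => ?; apply/andP; split; lra.
    have -> : s - t - (c n s - c n t) = (s - c n s) - (t - c n t) by ring.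
    apply: le_lt_trans (ler_normB _ _) _.
    have := close s s0 sL; have := close t t0 tL.
    by move: `|_| `|_| => a b *; lra.
  apply/eqP; rewrite eq_sym -subr_eq0 -normr_le0; apply/ler_addgt0Pl => e e0.
  rewrite addr0; have e20 : 0 < e / 2 by rewrite divr_gt0.
  near omega => n.
  have /ltr_normlP[h1 h2] :
      `| `|s - t| - mdist (sval (w s) n) (sval (w t) n)| < e / 2.
    by near: n; exact: near_st.
  have /ltr_normlP[h3 h4] : `|mdist (ulim (w s)) (ulim (w t)) -
      mdist (sval (w s) n) (sval (w t) n)| < e / 2.
    by near: n; exact: mdist_ulim_near.
  by rewrite ler_norml; apply/andP; split; lra.
Unshelve. all: by end_near. Qed.

(** Otherwise failing tuples exist for almost all [n]; their classes form a tuple of the limit ball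
    whose distances approximate those of the failing tuples, a contradiction. *)
Lemma ultralimit_dom_of M (r : {posnum R}) e : 0 < e ->
  \forall n \near omega, dom M e (pball (X n) r) (pball Xw r).
Proof.
move=> e0; have [//|bad] := in_ultra_setVsetC
  [set n | dom M e (pball (X n) r) (pball Xw r)] UF.
(* Where domination holds, the constant tuple serves as a default. *)
have xex n : exists x : 'I_M.+1 -> pball (X n) r,
    x ord0 = base (pball (X n) r) /\
    (~ dom M e (pball (X n) r) (pball Xw r) ->
     ~ exists2 y : 'I_M.+1 -> pball Xw r, y ord0 = base (pball Xw r) &
         forall i j, mdist (x i) (x j) - e <= mdist (y i) (y j)).
  have [d|/existsNP[x /not_implyP[x0 xbad]]] :=
      pselect (dom M e (pball (X n) r) (pball Xw r)).
    by exists (fun=> base (pball (X n) r)).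
  by exists x.
pose x n := projT1 (cid (xex n)).
have x0 n : x n ord0 = base (pball (X n) r) by have [] := projT2 (cid (xex n)).
have xbad n := (projT2 (cid (xex n))).2.
have /choice[u uE] (i : 'I_M.+1) : exists u : ubounded omega X,
    sval u = fun n => val (x n i).
  by apply: (@ubounded_ex _ r%:num); apply: nearW => n; exact: (valP (x n i)).
have ur i : mdist (base Xw) (ulim (u i)) <= r%:num.
  have [b bE ->] := base_ulimE; apply: mdist_ulim_le; apply: nearW => n.
  by rewrite bE uE; exact: (valP (x n i)).
pose y i : pball Xw r := exist _ (ulim (u i)) (ur i).
exfalso; have /filter_ex[n []] : (\forall n \near omega,
    (forall p : 'I_M.+1 * 'I_M.+1, `|mdist (ulim (u p.1)) (ulim (u p.2)) -
      mdist (sval (u p.1) n) (sval (u p.2) n)| < e) /\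
    ~ dom M e (pball (X n) r) (pball Xw r)).
  apply: filterI; last exact: bad.
  by apply: filter_forall => p; exact: mdist_ulim_near.
move=> close /xbad; apply; exists y.
  apply: val_inj; apply: base_ulim => k.
  by rewrite uE x0.
move=> i j; have /ltr_normlP[h1 h2] := close (i, j).
move: h1 h2; rewrite /= !uE.
rewrite (_ : mdist (y i) (y j) = mdist (ulim (u i)) (ulim (u j)))//.
rewrite (_ : mdist (x n i) (x n j) = mdist (val (x n i)) (val (x n j)))//.
by move=> *; lra.
Qed.

(* The distance matrices of tuples that fail for [n] converge along [omega], so
   one tuple close to the limit matrix stands for all of them. *)
Lemma dom_of_ultralimit M (r : {posnum R}) e :
  (forall n, geodesic_space (X n)) -> 0 < e ->
  \forall n \near omega, dom M e (pball Xw r) (pball (X n) r).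
Proof.
move=> gX e0; have [//|bad] := in_ultra_setVsetC
  [set n | dom M e (pball Xw r) (pball (X n) r)] UF.
have e40 : 0 < e / 4 by rewrite divr_gt0.
have xex n : exists x : 'I_M.+1 -> pball Xw r,
    x ord0 = base (pball Xw r) /\
    (~ dom M e (pball Xw r) (pball (X n) r) ->
     ~ exists2 y : 'I_M.+1 -> pball (X n) r, y ord0 = base (pball (X n) r) &
         forall i j, mdist (x i) (x j) - e <= mdist (y i) (y j)).
  have [d|/existsNP[x /not_implyP[x0 xbad]]] :=
      pselect (dom M e (pball Xw r) (pball (X n) r)).
    by exists (fun=> base (pball Xw r)).
  by exists x.
have {xex}/choice[x xP] := xex.
pose a i j := lim (mdist (x n i) (x n j) @[n --> omega]).
have xa i j : mdist (x n i) (x n j) @[n --> omega] --> a i j.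
  apply: (@ultra_bounded_cvg _ _ _ _ (2 * r%:num)).
  by apply: nearW => n; rewrite mdist_ge0/=;
    exact: (pball_diam (x n i) (x n j)).
have xa_near : \forall n \near omega, forall p : 'I_M.+1 * 'I_M.+1,
    `|a p.1 p.2 - mdist (x n p.1) (x n p.2)| < e / 4.
  by apply: filter_forall => p; apply: cvgr_dist_lt => //; exact: xa.
have [m ma] := filter_ex xa_near.
(* Index 0 is lifted to the sequence of base points itself, so that its image is exactly the base
   point. *)
have /choice[u uP] (i : 'I_M.+1) : exists u : ubounded omega X,
    val (x m i) = ulim u /\ (i = ord0 -> forall n, sval u n = base (X n)).
  have [->|i0] := eqVneq i ord0.
    have [b bE bb] := base_ulimE; exists b.
    by rewrite (xP m).1 -bb; split=> // _ n; rewrite bE.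
  by have [u uE] := ulimE (val (x m i)); exists u; split=> // i0';
    rewrite i0' eqxx in i0.
have r0 : 0 <= r%:num by [].
(* The lifted points may lie slightly outside the closed ball of [X n]; the retraction brings them
   back. *)
pose f n := projT1 (cid (geodesic_retraction (gX n) r0)).
have fP n x' : mdist (base (X n)) (f n x') <= r%:num /\
    mdist x' (f n x') <= Num.max 0 (mdist (base (X n)) x' - r%:num).
  exact: (projT2 (cid (geodesic_retraction (gX n) r0))).
(* The error [e] is spent as follows: [e / 4] from the tuple at [n] to the limit matrix, [e / 4]
   from there to the tuple at [m], [e / 4] for lifting to [X n], and [e / 8] for retracting each
   endpoint. *)
exfalso; have /filter_ex[n [[[xn un] ur] nd]] : (\forall n \near omega,
    (((forall p : 'I_M.+1 * 'I_M.+1,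
         `|a p.1 p.2 - mdist (x n p.1) (x n p.2)| < e / 4) /\
      (forall p : 'I_M.+1 * 'I_M.+1, `|mdist (ulim (u p.1)) (ulim (u p.2)) -
         mdist (sval (u p.1) n) (sval (u p.2) n)| < e / 4)) /\
      (forall i, mdist (base (X n)) (sval (u i) n) <= r%:num + e / 8)) /\
    ~ dom M e (pball Xw r) (pball (X n) r)).
  apply: filterI; last exact: bad.
  apply: filterI; last first.
    apply: filter_forall => i; have [b bE bb] := base_ulimE.
    have e80 : 0 < e / 8 by rewrite divr_gt0.
    apply: filterS (mdist_ulim_near b (u i) e80) => n /ltr_normlP[+ _].
    have [<- _] := uP i; rewrite -bb bE.
    by have : mdist (base Xw) (val (x m i)) <= r%:num := valP (x m i); lra.
  apply: filterI; first exact: xa_near.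
  by apply: filter_forall => p; exact: mdist_ulim_near.
have [_ /(_ nd)] := xP n; apply.
have yr i := (fP n (sval (u i) n)).1.
pose y i : pball (X n) r := exist _ (f n (sval (u i) n)) (yr i).
exists y.
  apply: val_inj => /=; have [_ ->//] := uP ord0.
  apply/esym/mdist_positivity/le_anti; rewrite mdist_ge0 andbT.
  by apply: le_trans (fP n (base (X n))).2 _;
    rewrite mdistxx ge_max lexx sub0r oppr_le0.
move=> i j; rewrite (_ : mdist (y i) (y j) =
  mdist (f n (sval (u i) n)) (f n (sval (u j) n)))//.
have fu k : mdist (sval (u k) n) (f n (sval (u k) n)) <= e / 8.
  apply: le_trans (fP n (sval (u k) n)).2 _; rewrite ge_max; apply/andP; split.
    by rewrite ltW// divr_gt0.
  by rewrite lerBlDl; exact: ur.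
have /ltr_normlP[h1 h2] := ma (i, j); have /ltr_normlP[h3 h4] := xn (i, j).
have /ltr_normlP[h5 h6] := un (i, j); move: h1 h2 h3 h4 h5 h6 => /=.
rewrite (_ : mdist (x m i) (x m j) = mdist (val (x m i)) (val (x m j)))//.
have [-> _] := uP i; have [-> _] := uP j.
have := metric_triangle (sval (u i) n) (f n (sval (u i) n)) (sval (u j) n).
have := metric_triangle (f n (sval (u i) n)) (f n (sval (u j) n)) (sval (u j)
  n).
have := fu i; have := fu j; rewrite (metric_sym (f n (sval (u j) n))).
clear -e0; move: (mdist (x n i) (x n j)) (a i j) (mdist (ulim _) _) => *.
by lra.
Qed.

Lemma ultralimit_rho (r : {posnum R}) e :
  (forall n, geodesic_space (X n)) -> 0 < e ->
  \forall n \near omega, (rho (unit_pball (X n) r) (unit_pball Xw r) <= e%:E)%E.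
Proof.
move=> gX e0; have [M [eta [eta0 small]]] := rho_small_of_dom e0.
have re : 0 < r%:num * eta by rewrite mulr_gt0.
near=> n; apply: small; apply/dom_unit_pball; near: n.
  exact: ultralimit_dom_of.
exact: dom_of_ultralimit.
Unshelve. all: by end_near. Qed.

(** Only finitely many radii matter, so the corresponding sets of [omega] can be intersected. *)
Lemma ultralimit_rho0 e : (forall n, geodesic_space (X n)) -> 0 < e ->
  \forall n \near omega, (rho0 (X n) Xw < e%:E)%E.
Proof.
move=> gX e0; have [k small] := rho0_small_of_rationals e0.
have gw := ultralimit_geodesic gX.
have near_k : \forall n \near omega, forall i : 'I_k.+1,
    (rho_at (X n) Xw (rat_enum R i) < k.+1%:R^-1%:E)%E.
  apply: filter_forall => i.
  have k0 : 0 < (k.+1%:R^-1 : R) / 2 by rewrite divr_gt0// invr_gt0.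
  apply: filterS (ultralimit_rho (to_posnum (rat_enum R i)) gX k0) => n.
  move=> h; apply: le_lt_trans h _; rewrite lte_fin ltr_pdivrMr//.
  by rewrite ltr_pMr ?invr_gt0// ltrDl.
apply: filterS near_k => n nk; apply: small => // i ik.
exact: (nk (Ordinal (ik : i < k.+1)%N)).
Qed.

End ultralimits.

(** * From domination to correspondences *)

Section total_boundedness.
Variables (R : realType) (T : metricType R).

Definition sequences_cluster := forall u : nat -> T, exists l : T,
  forall (e : R) (N : nat), 0 < e -> exists2 n, (N <= n)%N & mdist l (u n) < e.

(** Without a finite net, a greedy choice gives a sequence whose terms are pairwise at distance at
    least [s], which cannot cluster. *)
Lemma sequences_cluster_net (s : R) : sequences_cluster -> 0 < s ->
  exists L : seq T, forall x, exists2 c, c \in L & mdist c x < s.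
Proof.
move=> Tcl s0; apply: contrapT => /forallNP nonet.
have /choice[f fP] (L : seq T) : exists x, forall c, c \in L -> s <= mdist c x.
  have /existsNP[x xL] := nonet L; exists x => c cL.
  by rewrite leNgt; apply/negP => cx; apply: xL; exists c.
(* [L n] lists the first [n] chosen points, and [f (L n)] is the next one. *)
pose L := fix L n : seq T := if n is n'.+1 then f (L n') :: L n' else [::].
have Lmem m k : f (L m) \in L (m + k.+1)%N.
  elim: k => [|k IH]; first by rewrite addn1 /= mem_head.
  by rewrite addnS /= inE IH orbT.
have [l lP] := Tcl (fun n => f (L n)).
have s20 : 0 < s / 2 by rewrite divr_gt0.
have [m _ lm] := lP (s / 2) 0%N s20; have [n mn ln] := lP (s / 2) m.+1 s20.
have := fP (L n) (f (L m)); rewrite -(subnKC mn) addSnnS => /(_ (Lmem _ _)).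
rewrite -addSnnS subnKC//; have := metric_triangle (f (L m)) l (f (L n)).
by rewrite (metric_sym _ l) => *; lra.
Qed.

Lemma compact_sequences_cluster : compact [set: T] -> sequences_cluster.
Proof.
move=> cT u; have [|l [_ lP]] := cT (u @ \oo) _; first exact: filterT.
exists l => e N e0.
have [] := lP (u @` [set n | (N <= n)%N]) (ball l e).
- by exists N => // n Nn; exists n.
- exact: nbhsx_ballx.
- by move=> _ [[n Nn <-]]; rewrite ballEmdist; exists n.
Qed.

End total_boundedness.

Section packing.
Variable R : realType.
Implicit Types Y Z W : pmspace R.

(** Pigeonhole: two points near the same centre of an [s / 2]-net are closer than [s]. *)
Lemma compact_packing_bound Y (s : R) : compact [set: Y] -> 0 < s ->
  exists K : nat, forall n (y : 'I_n.+1 -> Y),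
    (forall i j, i != j -> s < mdist (y i) (y j)) -> (n < K)%N.
Proof.
move=> /compact_sequences_cluster cY s0.
have s20 : 0 < s / 2 by rewrite divr_gt0.
have [L net] := sequences_cluster_net cY s20.
exists (size L).+1 => n y ysep; rewrite ltnS.
have /choice[c cP] (i : 'I_n.+1) : exists c : 'I_(size L),
    mdist (nth (base Y) L c) (y i) < s / 2.
  have [c cL cy] := net (y i).
  by exists (Ordinal (etrans (index_mem c L) cL)); rewrite /= nth_index.
have ci : injective c.
  move=> i j cij; apply/eqP; apply: contraT => /ysep.
  have := cP i; have := cP j; rewrite cij.
  have := metric_triangle (y i) (nth (base Y) L (c j)) (y j).
  by rewrite (metric_sym (y i) (nth _ _ _)) => *; lra.
by have := leq_card _ ci; rewrite !card_ord => /ltnW.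
Qed.

(** Appending [p] at the last index leaves the base point at index 0. *)
Let ext W n (w : 'I_n.+1 -> W) (p : W) (k : 'I_n.+2) : W :=
  if unlift ord_max k is Some i then w i else p.

Let ext0 W n (w : 'I_n.+1 -> W) p : ext w p ord0 = w ord0.
Proof.
rewrite /ext; case: unliftP => [i /(congr1 val) /= i0|//].
congr w; apply: val_inj => /=; move: i0; rewrite /bump leqNgt ltn_ord.
by [].
Qed.

Let ext_sep W n (w : 'I_n.+1 -> W) p (c : R) :
  (forall i j, i != j -> c < mdist (w i) (w j)) ->
  (forall i, c < mdist p (w i)) ->
  forall k l, k != l -> c < mdist (ext w p k) (ext w p l).
Proof.
move=> wc pc k l; rewrite /ext.
case: unliftP => [i ->|->]; case: unliftP => [j ->|->] //.
- by move=> ij; apply: wc; apply: contraNneq ij => ->.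
- by rewrite metric_sym.
- by rewrite eqxx.
Qed.

(* A maximal [e]-separated tuple with nearly maximal sum of distances can gain
   little when sent to [Z] and back, so its image in [Z] is nearly isometric;
   maximality makes both tuples nets. *)
Lemma pcorr_of_dom Y (D e : R) : compact [set: Y] ->
  (forall x y : Y, mdist x y <= D) -> 0 < e ->
  exists (M : nat) (eta : R), 0 < eta /\
    forall Z, dom M eta Y Z -> dom M eta Z Y -> pcorr (11 * e) Y Z.
Proof.
move=> cY diamY e0; have [K pack] := compact_packing_bound cY e0.
pose sep n (y : 'I_n.+1 -> Y) :=
  y ord0 = base Y /\ forall i j, i != j -> e < mdist (y i) (y j).
pose P n := `[< exists y, @sep n y >].
have P0 : exists n, P n.
  exists 0%N; apply/asboolP; exists (fun=> base Y); split=> // i j.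
  by rewrite (ord1 i) (ord1 j).
have PK n : P n -> (n <= K)%N by move=> /asboolP[y [_ /pack]]; exact: ltnW.
case: (ex_maxnP P0 PK) => m /asboolP[y1 y1sep] mmax.
pose S (y : 'I_m.+1 -> Y) : R := \sum_p mdist (y p.1) (y p.2).
pose E := [set S y | y in @sep m].
have supE : has_sup E.
  split; first by exists (S y1); exists y1.
  exists (\sum_(p : 'I_m.+1 * 'I_m.+1) D) => _ [y _ <-].
  by apply: ler_sum => p _; exact: diamY.
have [_ [y [y0 ysep] <-] ysup] := sup_adherent e0 supE.
(* Strict separation of a finite tuple leaves a margin [delta], so tuples with slightly smaller
   distances remain separated. *)
have [delta [delta0 deltay]] : exists delta : R, 0 < delta /\
    forall p : 'I_m.+1 * 'I_m.+1, p.1 != p.2 ->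
      e + delta <= mdist (y p.1) (y p.2).
  have sep_near : \forall d \near (0 : R)^'+, forall p : 'I_m.+1 * 'I_m.+1,
      p.1 != p.2 -> e + d <= mdist (y p.1) (y p.2).
    apply: filter_forall => -[i j] /=; have [->|ij] := eqVneq i j;
      first exact: nearW.
    have : 0 < mdist (y i) (y j) - e by rewrite subr_gt0 ysep.
    by move=> /nbhs_right_le; apply: filterS => d de _; lra.
  near (0 : R)^'+ => d; exists d; split; first by near: d; exact: nbhs_right_gt.
  by near: d.
pose m2 : R := #|{: 'I_m.+1 * 'I_m.+1}|%:R.
have m20 : 0 < m2 by rewrite ltr0n card_prod card_ord.
(* The bound by [delta / 4] preserves separation after a round trip, and the last one keeps the
   total loss over all pairs at most [e]. *)
pose eta := Num.min (delta / 4) (Num.min (e / 4) (e / (2 * m2))).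
have eta0 : 0 < eta by rewrite !lt_min !divr_gt0 ?mulr_gt0.
have eta_d : 4 * eta <= delta.
  by rewrite mulrC -ler_pdivlMr// ge_min lexx.
have eta_e : 4 * eta <= e.
  by rewrite mulrC -ler_pdivlMr// !ge_min lexx orbT.
have eta_m : 2 * eta * m2 <= e.
  rewrite mulrAC mulrC -ler_pdivlMr ?mulr_gt0//.
  by rewrite !ge_min lexx !orbT.
exists m.+1, eta; split=> // Z YZ ZY.
have [z z0 yz] := dom_leq (leqnSn m) YZ y0.
have [y' y'0 zy'] := dom_leq (leqnSn m) ZY z0.
have yy' i j : mdist (y i) (y j) - 2 * eta <= mdist (y' i) (y' j).
  by have := yz i j; have := zy' i j => *; lra.
have y'sep : sep m y'.
  split=> // i j ij; have := yy' i j; have := deltay (i, j) ij => /= *; lra.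
(* The terms [t p] are nonnegative. Their sum is at most [2 * e], because [S y] is within [e] of the
   supremum, so each of them is at most [2 * e]. *)
have gain i j : mdist (y' i) (y' j) - mdist (y i) (y j) <= 2 * e.
  pose t (p : 'I_m.+1 * 'I_m.+1) :=
    mdist (y' p.1) (y' p.2) - mdist (y p.1) (y p.2) + 2 * eta.
  have t0 p : 0 <= t p by have := yy' p.1 p.2; rewrite /t => *; lra.
  have tE : \sum_p t p = S y' - S y + 2 * eta * m2.
    rewrite big_split/= sumrB; congr +%R.
    by rewrite sumr_const /m2 mulr_natr; congr (_ *+ _); exact: eq_card.
  have : t (i, j) <= \sum_p t p by rewrite (bigD1 (i, j))//= lerDl sumr_ge0.
  have : S y' <= sup E by apply: ub_le_sup; [exact: supE.2|exists y'].
  by rewrite tE /t /= => *; lra.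
have zy i j : `|mdist (y i) (y j) - mdist (z i) (z j)| <= 3 * e.
  have := yz i j; have := zy' i j; have := gain i j => *.
  by rewrite ler_norml; apply/andP; split; lra.
have nosep (w : 'I_m.+2 -> Y) : ~ sep m.+1 w.
  by move=> wsep; have := mmax m.+1 (asboolT (ex_intro _ w wsep)); rewrite ltnn.
have ynet u : exists i, mdist u (y i) <= 2 * e.
  apply: contrapT => /forallNP far; apply: (nosep (ext y u)); split.
    by rewrite ext0.
  by apply: ext_sep => // i; have /negP := far i; rewrite -ltNge; lra.
(* A far point of [Z] would extend [z], and the longer tuple sent back to [Y] would contradict the
   maximality of [m]; this is why domination is required at [m.+1]. *)
have znet v : exists i, mdist v (z i) <= 2 * e.
  apply: contrapT => /forallNP far.
  have [|w w0 zw] := ZY (ext z v); first by rewrite ext0.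
  apply: (nosep w); split=> // k l kl; have := zw k l.
  suff : e + eta < mdist (ext z v k) (ext z v l) by lra.
  apply: ext_sep kl => [i j ij|i].
    by have := yz i j; have := deltay (i, j) ij => /= *; lra.
  by have /negP := far i; rewrite -ltNge; lra.
(* The distortion is [3 * e] between the two nets plus four displacements of [2 * e], hence the
   factor 11. *)
exists (fun u v => exists i, mdist u (y i) <= 2 * e /\ mdist v (z i) <= 2 * e).
split.
- by exists ord0; rewrite y0 z0 !mdistxx; split; rewrite mulr_ge0// ltW.
- by move=> u; have [i ui] := ynet u; exists (z i), i;
  rewrite mdistxx mulr_ge0// ltW.
- by move=> v; have [i vi] := znet v; exists (y i), i;
  rewrite mdistxx mulr_ge0// ltW.
- move=> u v u' v' [i [ui vi]] [j [uj vj]].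
  have /ler_normlP[h1 h2] := zy i j.
  have := metric_triangle u (y i) u'; have := metric_triangle (y i) (y j) u'.
  have := metric_triangle (y i) u (y j); have := metric_triangle u u' (y j).
  have := metric_triangle v (z i) v'; have := metric_triangle (z i) (z j) v'.
  have := metric_triangle (z i) v (z j); have := metric_triangle v v' (z j).
  rewrite (metric_sym (y i) u) (metric_sym (z i) v) (metric_sym (y j) u').
  rewrite (metric_sym (z j) v').
  clear -ui vi uj vj h1 h2 e0 => *.
  by rewrite ler_norml; apply/andP; split; lra.
Unshelve. all: by end_near. Qed.

End packing.

(** * Isometry of proper spaces from correspondences between their balls *)

Section proper_isometry.
Variable R : realType.
Implicit Types X Y : pmspace R.

Lemma ultra_image (T U : Type) (F : set_system T) (f : T -> U) :
  UltraFilter F -> UltraFilter (f @ F).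
Proof.
move=> UF; split=> [|G GF uG]; first exact: fmap_proper_filter.
apply/seteqP; split=> // A GA.
have [//|nuA] := in_ultra_setVsetC (f @^-1` A) UF.
have /(filterI GA) : G (~` A) by exact: uG.
by rewrite setICr => /filter_not_empty.
Qed.

Lemma proper_ultra_cvg Y (omega : set_system nat) (UF : UltraFilter omega)
    (u : nat -> Y) (M : R) : proper_space Y ->
  (\forall n \near omega, mdist (base Y) (u n) <= M) ->
  exists y, forall e : R, 0 < e -> \forall n \near omega, mdist y (u n) < e.
Proof.
move=> pY uM; have := pY (base Y) M; rewrite compact_ultra.
move=> /(_ (u @ omega) (ultra_image u UF) uM)[y [_ uy]]; exists y.
by apply/metricType_numDomainType.cvgrPdist_lt.
Qed.

(** Total maps on the whole spaces, with default values outside the balls, make different radii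
    comparable. The last estimate says that [f] and [g] are nearly inverse. *)
Lemma pball_pcorr_maps X Y (r : {posnum R}) (e : R) :
  pcorr e (pball X r) (pball Y r) -> exists (f : X -> Y) (g : Y -> X),
    [/\ forall x x', mdist (base X) x <= r%:num ->
      mdist (base X) x' <= r%:num ->
          `|mdist x x' - mdist (f x) (f x')| <= e,
        forall x, mdist (base X) x <= r%:num ->
          `|mdist (base X) x - mdist (base Y) (f x)| <= e,
        forall y, mdist (base Y) y <= r%:num ->
          `|mdist (base X) (g y) - mdist (base Y) y| <= e &
        forall x y, mdist (base X) x <= r%:num -> mdist (base Y) y <= r%:num ->
          `|mdist x (g y) - mdist (f x) y| <= e].
Proof.
move=> [Q [Q0 Q1 Q2 Qe]].
pose rel x y := exists (xr : mdist (base X) x <= r%:num)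
  (yr : mdist (base Y) y <= r%:num), Q (exist _ x xr) (exist _ y yr).
have relE x y x' y' : rel x y -> rel x' y' -> `|mdist x x' - mdist y y'| <= e.
  by move=> [xr [yr Qxy]] [xr' [yr' Qxy']]; exact: Qe Qxy Qxy'.
have rel0 : rel (base X) (base Y).
  have xr : mdist (base X) (base X) <= r%:num by rewrite mdistxx.
  have yr : mdist (base Y) (base Y) <= r%:num by rewrite mdistxx.
  exists xr, yr; suff <- : base (pball X r) = exist _ (base X) xr.
    by suff <- : base (pball Y r) = exist _ (base Y) yr by []; exact: val_inj.
  exact: val_inj.
have /choice[f fP] x : exists y, mdist (base X) x <= r%:num -> rel x y.
  have [xr|xr] := pselect (mdist (base X) x <= r%:num); last by exists (base Y).
  by have [[y yr] xy] := Q1 (exist _ x xr); exists y => _; exists xr, yr.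
have /choice[g gP] y : exists x, mdist (base Y) y <= r%:num -> rel x y.
  have [yr|yr] := pselect (mdist (base Y) y <= r%:num); last by exists (base X).
  by have [[x xr] xy] := Q2 (exist _ y yr); exists x => _; exists xr, yr.
exists f, g; split=> [x x' /fP xr /fP xr'|x /fP xr|y /gP yr|x y /fP xr /gP yr];
  exact: relE.
Qed.

Lemma nonprincipal_ultrafilter : exists2 omega : set_system nat,
  UltraFilter omega & \oo `<=` omega.
Proof. by have [G [UG sub]] := ultraFilterLemma eventually_filter;
  exists G. Qed.

(** Take radii tending to infinity and distortions tending to 0. Properness gives pointwise limits
    [F] and [G] of the maps along an ultrafilter; [F] preserves distances, and near inverseness
    passes to [F (G y) = y]. *)
Lemma proper_pcorr_pisometric X Y : proper_space X -> proper_space Y ->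
  (forall (r : {posnum R}) (e : R), 0 < e -> pcorr e (pball X r) (pball Y r)) ->
  pisometric X Y.
Proof.
move=> pX pY XY; have [omega UF oo_omega] := nonprincipal_ultrafilter.
pose rad k : {posnum R} := PosNum (ltr0Sn R k).
pose err k : R := k.+1%:R^-1.
have err0 k : 0 < err k by rewrite invr_gt0.
have /choice[f /choice[g fg]] k :=
  pball_pcorr_maps (XY (rad k) (err k) (err0 k)).
have err_small e : 0 < e -> \forall k \near omega, err k <= e.
  move=> e0; apply: oo_omega; exists (Num.truncn e^-1) => // k /= hk.
  rewrite invf_ple ?posrE// (le_trans (ltW (truncnS_gt _)))// ler_nat.
  by rewrite ltnS.
have rad_large (M : R) : \forall k \near omega, M <= (rad k)%:num.
  apply: oo_omega; exists (Num.truncn M) => // k /= hk.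
  by rewrite (le_trans (ltW (truncnS_gt _)))// ler_nat ltnS.
have /choice[F FP] x : exists y, forall e : R, 0 < e ->
    \forall k \near omega, mdist y (f k x) < e.
  apply: (@proper_ultra_cvg _ _ UF _ (mdist (base X) x + 1)) => //.
  near=> k; have [_ fk _ _] := fg k.
  have /ler_normlP[h1 h2] : `|mdist (base X) x - mdist (base Y) (f k x)| <= err
    k.
    by apply: fk; near: k; exact: rad_large.
  have : err k <= 1 by near: k; exact: err_small.
  by clear -h1 h2; lra.
have /choice[G GP] y : exists x, forall e : R, 0 < e ->
    \forall k \near omega, mdist x (g k y) < e.
  apply: (@proper_ultra_cvg _ _ UF _ (mdist (base Y) y + 1)) => //.
  near=> k; have [_ _ gk _] := fg k.
  have /ler_normlP[h1 h2] : `|mdist (base X) (g k y) - mdist (base Y) y| <= err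
    k.
    by apply: gk; near: k; exact: rad_large.
  have : err k <= 1 by near: k; exact: err_small.
  by clear -h1 h2; lra.
exists F; split.
- move=> x x'; apply/eqP; rewrite -subr_eq0 -normr_le0.
  apply/ler_addgt0Pl => e e0; rewrite addr0.
  have e30 : 0 < e / 3 by rewrite divr_gt0.
  near omega => k; have [fk _ _ _] := fg k.
  have /ler_normlP[h1 h2] : `|mdist x x' - mdist (f k x) (f k x')| <= err k.
    by apply: fk; near: k; exact: rad_large.
  have : err k <= e / 3 by near: k; exact: err_small.
  have : mdist (F x) (f k x) < e / 3 by near: k; exact: FP.
  have : mdist (F x') (f k x') < e / 3 by near: k; exact: FP.
  have := metric_triangle (F x) (f k x) (F x').
  have := metric_triangle (f k x) (f k x') (F x').
  have := metric_triangle (f k x) (F x) (f k x').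
  have := metric_triangle (F x) (F x') (f k x').
  rewrite (metric_sym (f k x') (F x')) (metric_sym (f k x) (F x)).
  by clear -h1 h2 => *; rewrite ler_norml; apply/andP; split; lra.
- move=> y; exists (G y); apply: mdist_positivity.
  apply/le_anti; rewrite mdist_ge0 andbT; apply/ler_addgt0Pl => e e0;
    rewrite addr0.
  have e30 : 0 < e / 3 by rewrite divr_gt0.
  near omega => k; have [_ _ _ fgk] := fg k.
  have /ler_normlP[h1 h2] : `|mdist (G y) (g k y) - mdist (f k (G y)) y| <= err
    k.
    by apply: fgk; near: k; exact: rad_large.
  have : err k <= e / 3 by near: k; exact: err_small.
  have : mdist (F (G y)) (f k (G y)) < e / 3 by near: k; exact: FP.
  have : mdist (G y) (g k y) < e / 3 by near: k; exact: GP.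
  have := metric_triangle (F (G y)) (f k (G y)) y.
  by clear -h1 h2 => *; lra.
- apply/esym/mdist_positivity/le_anti; rewrite mdist_ge0 andbT.
  apply/ler_addgt0Pl => e e0; rewrite addr0.
  have e20 : 0 < e / 2 by rewrite divr_gt0.
  near omega => k; have [_ fk _ _] := fg k.
  have := fk (base X); rewrite mdistxx =>
    /(_ (ltW (ltr0Sn R k))) /ler_normlP[h1 h2].
  have : err k <= e / 2 by near: k; exact: err_small.
  have : mdist (F (base X)) (f k (base X)) < e / 2 by near: k; exact: FP.
  have := metric_triangle (base Y) (f k (base X)) (F (base X)).
  rewrite (metric_sym (f k (base X)) (F (base X))).
  by clear -h1 h2 => *; lra.
Unshelve. all: by end_near. Qed.

End proper_isometry.

(** * Topologies *)

Section GH_topology.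
Variable R : realType.

Lemma H0T_nbhsP (C : H0T R) (U : set (H0T R)) : nbhs C U <->
  exists2 e : R, 0 < e & [set D : H0T R | (dGHc (val C) (val D) < e%:E)%E] `<=`
    U.
Proof.
rewrite nbhsE; split=> [[B [oB BC] BU]|[e e0 eU]].
  by have [e e0 eB] := oB C BC; exists e => //; exact: subset_trans BU.
exists [set D : H0T R | (dGHc (val C) (val D) < e%:E)%E] => //; split.
  move=> D /= CD; exists (e - fine (dGHc (val C) (val D))).
    rewrite subr_gt0 -lte_fin fineK// ge0_fin_numE ?dGH_ge0//.
    exact: lt_trans CD (ltry _).
  move=> E /= DE; have H0val (x : H0T R) : H0 (val x) by exact: set_valP.
  apply: le_lt_trans (dGHc_triangle (H0val C) (H0val D) (H0val E)) _.
  have CDfin : dGHc (val C) (val D) \is a fin_num.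
    by rewrite ge0_fin_numE ?dGH_ge0//; exact: lt_trans CD (ltry _).
  move: DE; rewrite EFinB fineK// lteBrDr// addeC.
  by rewrite addeC.
have cC : compact [set: repr (val C)] by apply: H0_compact; exact: set_valP.
have e20 : 0 < e / 2 by rewrite divr_gt0.
apply: (@le_lt_trans _ _ (e / 2)%:E);
  last by rewrite lte_fin ltr_pdivrMr// ltr_pMr// ltr1n.
apply: pcorr_dGH => //; apply: (@pcorrW _ 0); first by rewrite mulr_ge0// ltW.
exact/pisometric_pcorr/pisometric_refl.
Qed.

Lemma PG0_nbhs_ball (C : PG0T R) (r : {posnum R}) (e : R) : 0 < e ->
  nbhs C [set D | (dGHc (val (PG0_ball r C)) (val (PG0_ball r D)) < e%:E)%E].
Proof.
move=> e0; pose B := [set D : H0T R | (dGHc (val (PG0_ball r C)) (val D) <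
  e%:E)%E].
have CB : nbhs (PG0_ball r C) B by apply/H0T_nbhsP; exists e.
have /cvg_sup CC : nbhs C --> C by [].
exact: (CC r (PG0_ball r @^-1` B) (@initial_continuous _ _ (PG0_ball r) C B
  CB)).
Qed.

Lemma PG0_cvgP (F : set_system (PG0T R)) (C : PG0T R) : Filter F ->
  (forall (r : {posnum R}) (e : R), 0 < e ->
    F [set D | (dGHc (val (PG0_ball r C)) (val (PG0_ball r D)) < e%:E)%E]) ->
  F --> C.
Proof.
move=> FF FC; apply/cvg_sup => r A /=.
move=> [_ [[B oB <-] BC] BA].
have /H0T_nbhsP[e e0 eB] : nbhs (PG0_ball r C) B by exact: open_nbhs_nbhs.
apply: filterS (FC r e e0) => D /eB; exact: BA.
Qed.

End GH_topology.

(** An ultrafilter containing a singleton is principal; otherwise it contains all complements of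
    points, hence all tails. *)
Lemma nonprincipal_oo (omega : set_system nat) : UltraFilter omega ->
  (forall n, omega <> principal_filter n) -> \oo `<=` omega.
Proof.
move=> UF np; have nD n : omega (~` [set n]).
  have [wn|//] := in_ultra_setVsetC [set n] UF.
  case: (np n); apply/seteqP; split=> A.
    move=> wA; apply/principal_filterP.
    have wAn : omega (A `&` [set n]) by exact: filterI.
    by have [k [Ak kn]] := filter_ex wAn; rewrite -[n]kn.
  by move/principal_filterP => An; apply: filterS wn => _ ->.
have tail N : omega [set k | (N <= k)%N].
  elim: N => [|N IH]; first exact: filterS (@filterT _ _ _).
  apply: filterS (filterI IH (nD N)) => k /= [Nk kN].
  by rewrite ltn_neqAle Nk andbT; apply/eqP => kN'; apply: kN.
by move=> A [N _ NA]; exact: filterS NA (tail N).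
Qed.

(** * The metric on strong equivalence classes *)

Section strong_quotient.
Variable R : realType.
Implicit Types X Y : pmspace R.

(** A vanishing integral forces [rho] to vanish at every radius, again by equicontinuity in the
    radius. *)
Lemma rho0_eq0 X Y : geodesic_space X -> geodesic_space Y -> rho0 X Y = 0%E ->
  strong_equiv X Y.
Proof.
move=> gX gY XY0 r; apply/psim_unit_pball.
apply: (@rho0_psim _ _ _ 2); try exact: unit_pball_diam.
apply/eqP; rewrite eq_le rho_ge0 andbT; apply/lee_addgt0Pr => e e0.
have [theta theta0 small] := rho_at_of_rho0_small (gt0 r) e0.
have := small X Y gX gY; rewrite XY0 lte_fin => /(_ theta0) /ltW.
by rewrite add0e /rho_at (_ : to_posnum r%:num = r)//; exact/val_inj/to_posnumK.
Qed.

Definition G0q_repr (q : G0q R) : pmspace R := repr (val (repr q)).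

Lemma G0T_geodesic (C : G0T R) : geodesic_space (repr (val C)).
Proof.
case: C => C /= /set_mem[X gX <-].
exact: pisometric_geodesic (isoclassP X) gX.
Qed.

Lemma G0q_repr_geodesic (q : G0q R) : geodesic_space (G0q_repr q).
Proof. exact: G0T_geodesic. Qed.

Lemma strong_classP (C D : G0T R) : strong_class C = strong_class D <->
  strong_equiv (repr (val C)) (repr (val D)).
Proof.
split=> [/eqP|CD]; first by rewrite eqmodE => /asboolP.
by apply/eqP; rewrite eqmodE; apply/asboolP.
Qed.

Lemma strong_class_repr (C : G0T R) :
  strong_equiv (repr (val C)) (G0q_repr (strong_class C)).
Proof. by apply/strong_classP; rewrite /strong_class reprK. Qed.

Lemma strong_equiv_trans X Y Z : strong_equiv X Y -> strong_equiv Y Z ->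
  strong_equiv X Z.
Proof.
move=> XY YZ r; have [a b] := XY r; have [c d] := YZ r.
by split; [exact: pprecsim_trans c|exact: pprecsim_trans b].
Qed.

Lemma G0_class_repr X (gX : geodesic_space X) :
  strong_equiv X (G0q_repr (strong_class (G0_class gX))).
Proof.
apply: strong_equiv_trans (strong_class_repr _).
exact/pisometric_strong_equiv/isoclassP.
Qed.

Lemma G0q_repr_eq (p q : G0q R) :
  strong_equiv (G0q_repr p) (G0q_repr q) -> p = q.
Proof. by move=> pq; rewrite -[p]reprK -[q]reprK; exact/strong_classP. Qed.

Let d (p q : G0q R) : R := fine (rho0 (G0q_repr p) (G0q_repr q)).

Let dE p q : (d p q)%:E = rho0 (G0q_repr p) (G0q_repr q).
Proof. by rewrite fineK// rho0_fin_num//; exact: G0q_repr_geodesic. Qed.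

Let dxx p : d p p = 0. Proof. by rewrite /d rho0xx. Qed.

Let d_eq0 p q : d p q = 0 -> p = q.
Proof.
move=> pq; apply: G0q_repr_eq; apply: rho0_eq0; try exact: G0q_repr_geodesic.
by rewrite -dE pq.
Qed.

Let d_sym p q : d p q = d q p. Proof. by rewrite /d rho0_sym. Qed.

Let d_triangle q p s : d p s <= d p q + d q s.
Proof.
have := rho0_triangle (@G0q_repr_geodesic p) (@G0q_repr_geodesic q)
  (@G0q_repr_geodesic s).
by rewrite -(dE p s) -(dE p q) -(dE q s) -EFinD lee_fin.
Qed.

HB.instance Definition _ := isMetric.Build R (G0q R) dxx d_eq0 d_sym d_triangle.

Lemma mdist_G0q (p q : G0q R) :
  (mdist p q)%:E = rho0 (G0q_repr p) (G0q_repr q).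
Proof. exact: dE. Qed.

Lemma mdist_strong_class (C D : G0T R) :
  (mdist (strong_class C) (strong_class D))%:E = rho0 (repr (val C)) (repr (val
    D)).
Proof.
by rewrite mdist_G0q; apply: strong_equiv_rho0;
  exact/strong_equiv_sym/strong_class_repr.
Qed.

Lemma mdist_G0_class X Y (gX : geodesic_space X) (gY : geodesic_space Y) :
  (mdist (strong_class (G0_class gX)) (strong_class (G0_class gY)))%:E = rho0 X
    Y.
Proof.
by rewrite mdist_G0q; apply: strong_equiv_rho0;
  exact/strong_equiv_sym/G0_class_repr.
Qed.

End strong_quotient.

(** * Compactness from cluster points of sequences *)

Section sequential_compactness.
Variables (R : realType) (T : metricType R).

Lemma ultra_finite_cover (F : set_system T) (UF : UltraFilter F) (L : seq T)
    (A : T -> set T) : F [set x | exists2 c, c \in L & A c x] ->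
  exists c, F (A c).
Proof.
elim: L => [|c L IH] FL.
  by have [x []] := filter_ex FL.
have [Fc|Fnc] := in_ultra_setVsetC (A c) UF; first by exists c.
apply: IH; apply: filterS (filterI FL Fnc) => x /= [[c' + Ac'] nAc].
by rewrite inE => /predU1P[c'c|]; [rewrite c'c in Ac'|exists c'].
Qed.

(** By total boundedness an ultrafilter contains a ball of radius [k.+1%:R^-1] for every [k]; a
    cluster point of the centres is its limit. *)
Lemma sequences_cluster_compact : sequences_cluster T -> compact [set: T].
Proof.
move=> Tcl; rewrite compact_ultra => F UF _.
have /choice[c cF] (k : nat) : exists c, F [set x | mdist c x < k.+1%:R^-1].
  have [|L net] := @sequences_cluster_net _ _ k.+1%:R^-1 Tcl;
    first by rewrite invr_gt0.
  apply: (@ultra_finite_cover _ UF L (fun c =>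
    [set x | mdist c x < k.+1%:R^-1])).
  by apply: filterS (@filterT _ _ _) => x _; exact: net.
have [l lP] := Tcl c; exists l; split=> //.
apply/metricType_numDomainType.fcvgrPdist_lt => e e0.
have e20 : 0 < e / 2 by rewrite divr_gt0.
have [n Nn ln] := lP (e / 2) (Num.truncn (e / 2)^-1) e20.
apply: filterS (cF n) => x /= cx.
have ne : n.+1%:R^-1 <= e / 2.
  rewrite invf_ple ?posrE// (le_trans (ltW (truncnS_gt _)))// ler_nat.
  by rewrite ltnS.
have := metric_triangle l (c n) x; move: cx ne ln.
by move: (n.+1%:R^-1) => *; lra.
Qed.

End sequential_compactness.

(** * Compactness of the quotient and embedding of proper spaces *)

Section strong_quotient_topology.
Variable R : realType.

(** The class of an ultralimit of representatives is a cluster point of the sequence. *)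
Lemma G0q_compact : compact [set: G0q R].
Proof.
apply: sequences_cluster_compact => u.
have [omega UF oo_omega] := nonprincipal_ultrafilter.
pose X n := G0q_repr (u n).
have gX n : geodesic_space (X n) by exact: G0q_repr_geodesic.
have gw := @ultralimit_geodesic _ _ UF _ gX.
exists (strong_class (G0_class gw)) => e N e0.
have near_N : omega [set n | (N <= n)%N] by apply: oo_omega; exists N.
have [n [Nn Xn]] := filter_ex (filterI near_N (@ultralimit_rho0 _ _ UF _ _ gX
  e0)).
exists n => //; rewrite -lte_fin mdist_G0q.
rewrite (strong_equiv_rho0 (strong_equiv_sym (G0_class_repr gw))
  (pisometric_strong_equiv (pisometric_refl (X n)))).
by rewrite rho0_sym.
Qed.

(** Almost every [X n] is [rho0]-close both to the ultralimit and to [Y]. *)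
Lemma ultralimit_strong_equiv (X : nat -> pmspace R) (Y : pmspace R)
    (omega : set_system nat) (UF : UltraFilter omega) :
  (forall n, geodesic_space (X n)) -> geodesic_space Y -> \oo `<=` omega ->
  rho0 (X n) Y @[n --> \oo] --> 0%E -> strong_equiv (ultralimit UF X) Y.
Proof.
move=> gX gY oo_omega XY0; have gw := @ultralimit_geodesic _ _ UF _ gX.
apply: rho0_eq0 => //; apply/eqP; rewrite eq_le rho0_ge0 andbT.
apply/lee_addgt0Pr => e e0; rewrite add0e.
have e20 : 0 < e / 2 by rewrite divr_gt0.
have XYe : omega [set n | (rho0 (X n) Y < (e / 2)%:E)%E].
  have nb : nbhs 0%E [set x : \bar R | (x < (e / 2)%:E)%E].
    apply: open_nbhs_nbhs; split; first exact: open_ereal_lt_ereal.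
    by rewrite /= lte_fin.
  exact: oo_omega _ (XY0 _ nb).
have [n [XYn Xwn]] := filter_ex (filterI XYe (@ultralimit_rho0 _ _ UF _ _ gX
  e20)).
apply: le_trans (rho0_triangle gw (gX n) gY) _.
have -> : e%:E = ((e / 2)%:E + (e / 2)%:E)%E by rewrite -EFinD -splitr.
apply: leeD; last exact: ltW XYn.
by rewrite rho0_sym; exact: ltW Xwn.
Qed.

Lemma PG0_geodesic (C : PG0T R) : geodesic_space (repr (val C)).
Proof.
case: C => C /= /set_mem[X [_ gX] <-].
exact: pisometric_geodesic (isoclassP X) gX.
Qed.

Lemma mdist_PG0_proj (C D : PG0T R) :
  (mdist (PG0_proj C) (PG0_proj D))%:E = rho0 (repr (val C)) (repr (val D)).
Proof. exact: mdist_strong_class. Qed.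

(** Balls of strongly equivalent spaces dominate each other with arbitrarily small error; being
    compact, they are related by correspondences of arbitrarily small distortion. *)
Lemma PG0_proj_inj : injective (@PG0_proj R).
Proof.
move=> C D /strong_classP/= CD; apply: val_inj.
rewrite -[val C]reprK -[val D]reprK; apply/eqP; rewrite eqmodE; apply/asboolP.
apply: proper_pcorr_pisometric; try exact: PG0_proper.
move=> r e e0; have e110 : 0 < e / 11 by rewrite divr_gt0.
have [M [eta [eta0 corr]]] := pcorr_of_dom
  (pball_compact (@PG0_proper R C)) (@pball_diam R (repr (val C)) r) e110.
have [CDr DCr] := CD r.
have -> : e = 11 * (e / 11) by field.
by apply: corr; [move/pprecsim_dom: CDr|move/pprecsim_dom: DCr]; exact.
Qed.

(** Closeness in [rho0] needs only finitely many radii, and at each of them Gromov-Hausdorff close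
    balls dominate each other. *)
Lemma PG0_proj_continuous : continuous (@PG0_proj R).
Proof.
move=> C; have FC : Filter (nbhs C) := nbhs_filter C.
apply/(@metricType_numDomainType.cvgrPdist_lt _ _ _ _ FC) => e e0.
have [k small] := rho0_small_of_rationals e0.
have near_i (i : nat) : \forall D \near C,
    (rho_at (repr (val C)) (repr (val D)) (rat_enum R i) < k.+1%:R^-1%:E)%E.
  have k0 : 0 < (k.+1%:R^-1 : R) / 2 by rewrite divr_gt0// invr_gt0.
  have [M [eta [eta0 rho_small]]] := rho_small_of_dom k0.
  pose r := to_posnum (rat_enum R i).
  have re0 : 0 < r%:num * eta / 2 by rewrite divr_gt0// mulr_gt0.
  near=> D; apply: (@le_lt_trans _ _ (k.+1%:R^-1 / 2)%:E); last first.
    by rewrite lte_fin ltr_pdivrMr// ltr_pMr ?invr_gt0// ltr1n.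
  have /dGHc_isoclass_lt :
      (dGHc (val (PG0_ball r C)) (val (PG0_ball r D)) < (r%:num * eta /
        2)%:E)%E.
    by near: D; exact: PG0_nbhs_ball.
  rewrite mulrC divfK// => CD.
  apply: rho_small; apply/dom_unit_pball; apply: pcorr_dom => //.
  exact: pcorr_sym.
have near_k : \forall D \near C, forall i : 'I_k.+1,
    (rho_at (repr (val C)) (repr (val D)) (rat_enum R i) < k.+1%:R^-1%:E)%E.
  exact: (@filter_forall _ _ _ _ FC (fun i : 'I_k.+1 => near_i i)).
apply: (@filterS _ _ FC _ _ _ near_k) => D CD; rewrite -lte_fin mdist_PG0_proj.
apply: small; try exact: PG0_geodesic.
by move=> i ik; exact: (CD (Ordinal (ik : i < k.+1)%N)).
Unshelve. all: by end_near. Qed.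

(** Continuity of the inverse. Small [rho0] gives small [rho] at radius [r], hence mutual
    domination, hence a correspondence; the constants [M] and [eta] depend only on the ball of [C],
    so [theta] serves all [D]. *)
Lemma PG0_proj_near (C : PG0T R) (U : set (PG0T R)) : nbhs C U ->
  exists2 theta : R, 0 < theta &
    forall D, mdist (PG0_proj C) (PG0_proj D) < theta -> U D.
Proof.
pose B (theta : R) := [set D : PG0T R | mdist (PG0_proj C) (PG0_proj D) <
  theta].
pose F : set_system (PG0T R) := filter_from [set theta : R | 0 < theta] B.
have FF : Filter F.
  apply: filter_from_filter; first by exists 1 => /=.
  move=> a b a0 b0; exists (Num.min a b) => [/=|D]; first by rewrite lt_min a0.
  by rewrite /B /= lt_min => /andP[].
suff FC : F --> C by move=> /FC[theta theta0 thetaU]; exists theta.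
apply: PG0_cvgP => r e e0; have e110 : 0 < e / 11 by rewrite divr_gt0.
have [M [eta [eta0 corr]]] := pcorr_of_dom
  (pball_compact (@PG0_proper R C)) (@pball_diam R (repr (val C)) r) e110.
have eta_r : 0 < r%:num^-1 * eta by rewrite mulr_gt0.
have [t t0 dom_small] := dom_of_rho_small M eta_r.
have [theta theta0 rho_small] := rho_at_of_rho0_small (gt0 r) t0.
exists theta => // D; rewrite /B /= -lte_fin mdist_PG0_proj => CD.
have := rho_small _ _ (PG0_geodesic (C := C)) (PG0_geodesic (C := D)) CD.
rewrite /rho_at (_ : to_posnum r%:num = r); last exact/val_inj/to_posnumK.
move=> CDr; have DCr := CDr; rewrite rho_sym in DCr.
have := dom_small _ _ (@unit_pball_diam R _ r) CDr.
have := dom_small _ _ (@unit_pball_diam R _ r) DCr.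
move=> /dom_unit_pball + /dom_unit_pball;
  rewrite mulrA divff// mul1r => DC {}CD.
have e20 : 0 < e / 2 by rewrite divr_gt0.
apply: (@le_lt_trans _ _ (e / 2)%:E);
  last by rewrite lte_fin ltr_pdivrMr// ltr_pMr// ltr1n.
apply: pcorr_dGHc => //; try exact/pball_compact/PG0_proper.
have -> : 2 * (e / 2) = 11 * (e / 11) by field.
exact: corr.
Qed.

Lemma PG0_proj_embedding : topological_embedding (@PG0_proj R).
Proof.
split; [exact: PG0_proj_inj|exact: PG0_proj_continuous|move=> U oU].
(* Points outside the range satisfy the condition vacuously, so on the range [V] is exactly the
   image of [U]. *)
pose V : set (G0q R) := [set m | forall D, PG0_proj D = m -> U D].
exists V^°; first exact: open_interior.
apply/seteqP; split=> [_ [C UC <-]|m [Vm [D _ Dm]]]; last first.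
  by exists D => //; exact: (interior_subset Vm).
split; last by exists C.
have [theta theta0 UP] := PG0_proj_near (open_nbhs_nbhs (conj oU UC)).
rewrite /interior /= -metricType_numDomainType.filter_from_mdist_nbhs.
exists theta => // m /= Cm D Dm.
by apply: UP; rewrite Dm.
Qed.

End strong_quotient_topology.

Theorem theorem1p4 (R : realType) :
  exists m : Metric R (G0q R), let M : metricType R := Metric.Pack m in
  [/\ (forall (X Y : pmspace R) (gX : geodesic_space X) (gY : geodesic_space Y),
         (@mdist R M (strong_class (G0_class gX))
                     (strong_class (G0_class gY)))%:E = rho0 X Y) /\
      compact [set: M],
      topological_embedding (@PG0_proj R : PG0T R -> M) &
      forall (X : nat -> pmspace R) (Y : pmspace R),
        (forall n, geodesic_space (X n)) -> geodesic_space Y ->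
        rho0 (X n) Y @[n --> \oo] --> 0%E ->
        forall (omega : set_system nat) (UF : UltraFilter omega),
          (forall n, omega <> principal_filter n) ->
          geodesic_space (ultralimit UF X) /\ strong_equiv (ultralimit UF X) Y].
Proof.
exists (Metric.class (G0q R)) => M; split.
- by split; [exact: mdist_G0_class|exact: G0q_compact].
- exact: PG0_proj_embedding.
- move=> X Y gX gY XY0 omega UF np; split; first exact: ultralimit_geodesic.
  exact: ultralimit_strong_equiv (nonprincipal_oo UF np) XY0.
Qed.
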